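(* Let $\mathcal{S}$ be a finite skew translation generalized quadrangle of order $s$ (i.e. of order $(s,s)$) with $s$ even. Then $\mathcal{S}$ is a translation generalized quadrangle.
   Context: A generalized quadrangle of order $(s,t)$ is a finite point-line incidence structure in which each line has $s+1$ points, each point lies on $t+1$ lines, and for each non-incident point-line pair $(P,\ell)$ there is a unique point on $\ell$ collinear with $P$; it has order $s$ if $s=t$. An elation about a point $P$ is an automorphism that is either the identity or fixes every line through $P$ and fixes no point not collinear with $P$; a symmetry about $P$ is an elation about $P$ that also fixes every point collinear with $P$. $\mathcal{S}$ is an elation generalized quadrangle with base point $P$ and elation group $G$ if $G$ is a group of automorphisms consisting of elations about $P$ acting regularly on the points not collinear with $P$. It is a skew translation generalized quadrangle if moreover $G$ contains a subgroup consisting of $t$ symmetries about $P$. It is a translation generalized quadrangle if it is an elation generalized quadrangle with an abelian elation group. *)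

(* Defs.v *)
From mathcomp Require Import all_boot all_fingroup.
Set Implicit Arguments. Unset Strict Implicit. Unset Printing Implicit Defensive.
Local Open Scope group_scope.

(* A finite point-line incidence structure: points Pt, lines Ln (finTypes),
   incidence relation I.  An automorphism candidate is a pair
   (permutation of points, permutation of lines); the type
   ({perm Pt} * {perm Ln}) carries the external direct product group law. *)

Section GQ.
Variables (Pt Ln : finType) (I : Pt -> Ln -> bool).

Notation aut_t := ({perm Pt} * {perm Ln})%type.

(* two points are collinear if some line contains both (a point is
   collinear with itself) *)
Definition collinear (x y : Pt) : bool := [exists l, I x l && I y l].

(* Generalized quadrangle of order (s,t) (Payne--Thas convention s,t >= 1):
   each line has s+1 points, each point is on t+1 lines, two distinct points
   are on at most one common line, and for every non-incident point-line
   pair (x,l) there is a unique point on l collinear with x. *)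
Definition is_GQ (s t : nat) : Prop :=
  [/\ (1 <= s)%N /\ (1 <= t)%N,
      forall l : Ln, #|[set x | I x l]| = s.+1,
      forall x : Pt, #|[set l | I x l]| = t.+1,
      forall (x y : Pt) (l m : Ln), x != y -> I x l -> I y l -> I x m -> I y m -> l = m
    & forall (x : Pt) (l : Ln), ~~ I x l -> #|[set y | I y l & collinear x y]| = 1%N].

Definition is_aut (g : aut_t) : Prop :=
  forall (x : Pt) (l : Ln), I (g.1 x) (g.2 l) = I x l.

Definition is_elation (p : Pt) (g : aut_t) : Prop :=
  is_aut g /\
  (g = 1 \/
   ((forall l : Ln, I p l -> g.2 l = l) /\
    (forall x : Pt, ~~ collinear p x -> g.1 x != x))).

Definition is_symmetry (p : Pt) (g : aut_t) : Prop :=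
  is_elation p g /\ (forall x : Pt, collinear p x -> g.1 x = x).

(* elation generalized quadrangle with base point p and elation group G
   (the GQ structure itself is assumed separately) *)
Definition is_EGQ (p : Pt) (G : {group aut_t}) : Prop :=
  (forall g, g \in G -> is_elation p g) /\
  (forall x y : Pt, ~~ collinear p x -> ~~ collinear p y ->
     #|[set g in G | g.1 x == y]| = 1%N).

Definition is_STGQ (t : nat) (p : Pt) (G : {group aut_t}) : Prop :=
  is_EGQ p G /\
  exists H : {group aut_t},
    [/\ H \subset G, #|H| = t & forall g, g \in H -> is_symmetry p g].

Definition is_TGQ : Prop :=
  exists (p : Pt) (G : {group aut_t}), is_EGQ p G /\ abelian G.

End GQ.

(* Main.v *)
Require Import Defs.
From mathcomp Require Import all_boot all_fingroup.
From mathcomp Require Import all_solvable all_algebra all_field all_character.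
From mathcomp Require Import zify.
Set Implicit Arguments. Unset Strict Implicit. Unset Printing Implicit Defensive.
Local Open Scope group_scope.

(** Let y0 be a point not collinear with p.  The stabilizers A_l of the s + 1
    lines on y0 (indexed by the lines l on p) and the group Z of all symmetries
    about p form an Ahrens-Szekeres configuration: every element of G lies in
    some A_l Z, and E = \bigcup A_l meets every coset g A_l off A_l Z in exactly
    one element.  All elements of E are involutions because the A_l Z / Z form a
    spread of G / Z and s is even.  The configuration (with |Z| <= s) passes to
    quotients by subgroups <z> of Z, so by induction on |Z| we may assume that
    the commutators of G lie in a central subgroup <z> of Z of order 2; we show
    that G has exponent 2.

    Every element of C_G(A_l) outside A_l Z is an involution.  If Z is not
    central, this, the fact that a noncentral element centralizes at most two of
    the A_l (exactly one if it centralizes Z), and the nondegeneracy of the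
    commutator form on G / Z(G) force either more than 3/4 of the elements of G
    to be involutions, or C_G(Z) to be an elementary abelian group that is too
    large to be totally isotropic.  If Z is central of exponent greater than 2,
    then Z = Z(G), and an irreducible representation in which z acts as -1 has
    degree s; it sends the sum of E to a matrix M with M^2 = s^2 and trace s, so
    the idempotent (1 + M / s) / 2 has trace (s + 1) / 2, which is not an
    integer. *)

(** * Groups of exponent 2 and commutator duality *)

(* The same cardinal can be elaborated along two inheritance paths from
   finGroupType to finType, which lia would treat as distinct atoms. *)
Ltac norm_card :=
  change (fingroup_FinStarMonoid__to__fintype_Finite
            (fingroup_FinGroup__to__fingroup_FinStarMonoid ?T))
    with (fingroup_FinGroup__to__fintype_Finite T) in *.
Ltac card_lia := norm_card; lia.
Ltac card_nia := norm_card; nia.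

Definition exp2 (gT : finGroupType) (A : {set gT}) := {in A, forall x, x ^+ 2 = 1}.

Section Exponent2.
Variable gT : finGroupType.
Implicit Types (x y : gT) (A B : {set gT}) (C G H P : {group gT}).

Lemma expg2_inv x : x ^+ 2 = 1 -> x^-1 = x.
Proof. by rewrite expgS expg1 => h; apply: (mulgI x); rewrite mulgV h. Qed.

Lemma expg2_commute x y :
  x ^+ 2 = 1 -> y ^+ 2 = 1 -> (x * y) ^+ 2 = 1 -> commute x y.
Proof.
move=> hx hy /expg2_inv; rewrite invMg (expg2_inv hx) (expg2_inv hy).
by move=> h; apply: esym.
Qed.

Lemma expg2M x y : commute x y -> x ^+ 2 = 1 -> y ^+ 2 = 1 -> (x * y) ^+ 2 = 1.
Proof. by move=> c hx hy; rewrite expgMn // hx hy mulg1. Qed.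

Lemma exp2_abelian G : exp2 G -> abelian G.
Proof.
move=> h; apply/centsP => x xG y yG.
by apply: expg2_commute; apply: h => //; rewrite groupM.
Qed.

Lemma exp2_mulg A B : exp2 A -> exp2 B -> A \subset 'C(B) -> exp2 (A * B).
Proof.
move=> hA hB /centsP c _ /mulsgP[a b aA bB ->].
by apply: expg2M; [apply: c | apply: hA | apply: hB].
Qed.

(* An involution x outside P whose product with p in P is again an involution
   inverts p; when two elements and their product all lie outside P, the
   elements of P are inverted by x, y and xy, hence are involutions. *)
Lemma exp2_outside C P :
  {in C :\: P, forall x, x ^+ 2 = 1} -> (2 * #|C :&: P| < #|C|)%N -> exp2 C.
Proof.
move=> h cCP p pC; case: (boolP (p \in P)) => pP; last first.
  by apply: h; rewrite !inE pP.
have inv x : x \in C -> x \notin P -> p ^ x = p^-1.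
  move=> xC xP; have hx : x ^+ 2 = 1 by apply: h; rewrite !inE xP.
  have hxp : (x * p) ^+ 2 = 1.
    by apply: h; rewrite inE groupMr // xP groupM.
  have := expg2_inv hxp; rewrite invMg conjgE (expg2_inv hx) => e.
  by rewrite mulgA -e -mulgA -expg2 hx mulg1.
have [x /setDP[xC xP]] : exists x, x \in C :\: P.
  by apply/set0Pn; rewrite -card_gt0 cardsD; card_lia.
have [y /setDP[/setDP[yC yP] xyP]] :
    exists y, y \in (C :\: P) :\: (x^-1 *: (C :&: P)).
  apply/set0Pn; rewrite -card_gt0 !cardsD.
  have := subset_leq_card (subsetIr (C :\: P) (x^-1 *: (C :&: P))).
  by rewrite card_lcoset; card_lia.
have xyP' : x * y \notin P.
  by apply: contra xyP => xyP; rewrite mem_lcoset invgK inE xyP groupM.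
have := inv (x * y) (groupM xC yC) xyP'.
rewrite conjgM (inv x) // conjVg (inv y) // invgK expgS expg1 => {1}->.
by rewrite mulVg.
Qed.

(** The class of [x] under [Y] has one or two elements; doubling avoids a division. *)
Lemma cent1_class2_index (z x : gT) (Y : {group gT}) :
  {in Y, forall y, x ^ y \in [set x; x * z]} ->
  (2 * #|'C_Y[x]| = if x \in 'C(Y) then 2 * #|Y| else #|Y|)%N.
Proof.
move=> h; case: ifP => [xC|xC].
  congr (2 * _)%N; apply: eq_card => y; rewrite !inE.
  case: (boolP (y \in Y)) => //= yY.
  by rewrite conjg_set1 sub1set inE conjgE (centP xC) // mulKg eqxx.
have := index_cent1 Y x; have := Lagrange (subsetIl Y 'C[x]).
have : (#|x ^: Y| <= 2)%N.
  apply: (@leq_trans #|[set x; x * z]|); last by rewrite cards2; case: eqP.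
  by apply: subset_leq_card; apply/subsetP => _ /imsetP[y yY ->]; apply: h.
have : (1 < #|x ^: Y|)%N.
  rewrite ltnNge; apply: contraFN xC => c1.
  have e : x ^: Y = [set x].
    by apply/eqP; rewrite eq_sym eqEcard sub1set class_refl cards1.
  apply/centP => y yY; apply/commgP/conjg_fixP.
  by have := memJ_class x yY; rewrite e inE => /eqP.
move=> c1 c2 <- ->; have -> : #|x ^: Y| = 2 by card_lia.
by rewrite mulnC.
Qed.

Lemma sum_cent1_sym (X Y : {group gT}) :
  (\sum_(x in X) #|'C_Y[x]| = \sum_(y in Y) #|'C_X[y]|)%N.
Proof.
under eq_bigr do rewrite -sum1_card.
under [RHS]eq_bigr do rewrite -sum1_card.
rewrite (exchange_big_dep [in Y]) /=; last by move=> x y _; rewrite inE => /andP[].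
apply: eq_bigr => y yY; apply: eq_bigl => x.
by rewrite !in_setI yY /= [y \in 'C[x]]cent1C.
Qed.

(* Commutators in <[z]> with #[z] = 2 make the commutator map a bilinear form
   over F_2, and this is the equality of its left and right ranks. *)
Lemma cent_duality (z : gT) (X Y : {group gT}) :
  {in X & Y, forall x y, x ^ y \in [set x; x * z]} ->
  {in Y & X, forall y x, y ^ x \in [set y; y * z]} ->
  (#|Y| * #|'C_X(Y)| = #|X| * #|'C_Y(X)|)%N.
Proof.
(* Twice the number of commuting pairs counts |B| for every x in A and once more for x centralizing
   B. The number of pairs is symmetric in A and B. *)
have half (A B : {group gT}) :
    {in A & B, forall x y, x ^ y \in [set x; x * z]} ->
    (2 * \sum_(x in A) #|'C_B[x]| = #|B| * (#|A| + #|'C_A(B)|))%N.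
  move=> h; rewrite big_distrr /=.
  rewrite (eq_bigr (fun x => (#|B| + (x \in 'C(B)) * #|B|)%N)); last first.
    move=> x xA; rewrite (@cent1_class2_index z); last by move=> y; apply: h.
    by case: (x \in _); card_lia.
  rewrite big_split /= sum_nat_const mulnDr [(#|A| * _)%N]mulnC; congr (_ + _)%N.
  rewrite -big_distrl /= mulnC; congr (_ * _)%N.
  rewrite -sum1_card big_mkcond /= [RHS]big_mkcond /=.
  by apply: eq_bigr => x _; rewrite inE; case: (x \in A).
move=> hXY hYX; have := half X Y hXY; have := half Y X hYX.
by rewrite sum_cent1_sym => ->; card_lia.
Qed.

(** If I is the set of elements of square 1 and x is in I, then I and x^-1 I share more than half of
    G, and the shared elements commute with x. So I is central and Z(G) has index less than 2. *)
Lemma exp2_three_quarters G :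
  (3 * #|G| < 4 * #|[set x in G | x ^+ 2 == 1]%g|)%N -> abelian G.
Proof.
set I := [set x in G | _] => hI.
have sIG : I \subset G by apply/subsetP => x; rewrite inE => /andP[].
have sIZ : I \subset 'Z(G).
  apply/subsetP => x; rewrite inE => /andP[xG /eqP hx].
  have sK : I :&: (x^-1 *: I) \subset 'C_G[x].
    apply/subsetP => y /setIP[/setIdP[yG /eqP hy]].
    rewrite mem_lcoset invgK => /setIdP[_ /eqP hxy].
    by apply/setIP; split=> //; apply/cent1P/commute_sym/expg2_commute.
  have lK := subset_leq_card sK.
  have cI : (#|I| + #|x^-1 *: I| = #|I :|: (x^-1 *: I)| + #|I :&: (x^-1 *: I)|)%N.
    by rewrite cardsUI.
  have lU : (#|I :|: (x^-1 *: I)| <= #|G|)%N.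
    apply: subset_leq_card; rewrite subUset sIG.
    apply/subsetP => y; rewrite mem_lcoset invgK => /(subsetP sIG).
    by rewrite groupMl.
  rewrite card_lcoset in cI.
  have eC : 'C_G[x] = G.
    apply/eqP; rewrite eqEsubset subsetIl /=; apply/negPn/negP => nC.
    have lt1 : (1 < #|G : 'C_G[x]|)%N by rewrite indexg_gt1.
    have : (#|'C_G[x]| * 2 <= #|G|)%N.
      by rewrite -(Lagrange (subsetIl G 'C[x])) leq_mul2l lt1 orbT.
    by clear -lU lK cI hI; card_lia.
  by rewrite inE xG; apply/centP => y; rewrite -{1}eC inE => /andP[_ /cent1P].
have lZ := subset_leq_card sIZ.
have eZ : 'Z(G) = G.
  apply/eqP; rewrite eqEsubset center_sub /=; apply/negPn/negP => nC.
  have lt1 : (1 < #|G : 'Z(G)|)%N by rewrite indexg_gt1.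
  have : (#|'Z(G)| * 2 <= #|G|)%N.
    by rewrite -(Lagrange (center_sub G)) leq_mul2l lt1 orbT.
  clear -lZ hI; card_lia.
by rewrite -eZ; apply: center_abelian.
Qed.

(** Double count of the pairs (g, e) with e in gA: as X is a union of left cosets of A, each e in X
    occurs for |A| elements g. *)
Lemma sum_card_lcosetI (X E : {set gT}) (A : {group gT}) :
  X * A = X -> (\sum_(g in X) #|(g *: A) :&: E| = #|A| * #|E :&: X|)%N.
Proof.
move=> hX; under eq_bigr do rewrite -sum1_card.
rewrite (exchange_big_dep [in E :&: X]) /=; last first.
  move=> g e gX /setIP[/lcosetP[a aA ->] eE]; rewrite inE eE -hX.
  by apply/mulsgP; exists g a.
rewrite mulnC -sum_nat_const; apply: eq_bigr => e /setIP[eE eX].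
rewrite sum1dep_card -(card_lcoset A e); apply: eq_card => g.
rewrite !inE eE andbT -lcoset_sym mem_lcoset.
case: (boolP (e^-1 * g \in A)) => [h|]; last by rewrite andbF.
by rewrite andbT -hX; apply/mulsgP; exists e (e^-1 * g); rewrite ?mulKVg.
Qed.

End Exponent2.

(** * Ahrens-Szekeres configurations *)

Lemma double_count (T J : finType) (X : {set T}) (B : J -> {set T}) :
  (\sum_(g in X) #|[set j | g \in B j]| = \sum_j #|X :&: B j|)%N.
Proof.
under eq_bigr do rewrite -sum1dep_card.
under [RHS]eq_bigr do rewrite -sum1_card.
rewrite (exchange_big_dep predT) //=; apply: eq_bigr => j _.
by apply: eq_bigl => g; rewrite inE.
Qed.

Lemma index2_meet (gT : finGroupType) (G N B : {group gT}) :
  B \subset G -> N \subset G -> #|G| = (2 * #|N|)%N -> ~~ (B \subset N) ->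
  (2 * #|B :&: N| = #|B|)%N.
Proof.
move=> sBG sNG cG nBN; have N0 := cardG_gt0 N.
have le1 : (#|(B * N)%g| <= 2 * #|N|)%N.
  by rewrite -cG; apply: subset_leq_card; rewrite mul_subG.
have := mul_cardG B N => e.
have lt1 : (1 < #|B : B :&: N|)%N by rewrite indexg_gt1 subsetI subxx.
have : (#|B :&: N| * 2 <= #|B|)%N.
  by rewrite -(Lagrange (subsetIl B N)) leq_mul2l lt1 orbT.
by move=> le2; norm_card; nia.
Qed.

(* Ahrens-Szekeres configuration, with an index set J in place of 0..s and with
   |Z| <= s instead of |Z| = s so that it survives quotients by subgroups of Z.
   AS_adj is the quadrangle axiom for a point and the line A_j: a coset of A_j
   outside A_j Z contains s / |Z| elements of the union of the A_i. *)
Record AS_family (gT : finGroupType) (J : finType) (s : nat)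
    (G Z : {group gT}) (A : J -> {group gT}) : Prop := ASFamily {
  AS_cardJ : #|J| = s.+1;
  AS_even : ~~ odd s;
  AS_pos : (0 < s)%N;
  AS_normal : Z <| G;
  AS_leZ : (#|Z| <= s)%N;
  AS_sub : forall j, A j \subset G;
  AS_card : forall j, #|A j| = s;
  AS_cardG : #|G| = (s * s * #|Z|)%N;
  AS_TI : forall i j, i != j -> A i :&: (A j * Z) \subset [1];
  AS_adj : forall j g, g \in G -> g \notin A j * Z ->
    (#|(g *: A j) :&: \bigcup_i A i| * #|Z| = s)%N
}.

(** Both extra properties pass to quotients by subgroups of Z; [AS_2group] is a field because it is
    deduced from the family only when |Z| = s. *)
Record AS_config (gT : finGroupType) (J : finType) (s : nat)
    (G Z : {group gT}) (A : J -> {group gT}) : Prop := ASConfig {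
  AS_config_family :> AS_family s G Z A;
  AS_2group : 2.-group G;
  AS_exp2 : forall j, exp2 (A j)
}.

(** * Covering and intersection properties of the components A_j Z *)

Section Family.
Variables (gT : finGroupType) (J : finType) (s : nat).
Variables (G Z : {group gT}) (A : J -> {group gT}).
Hypothesis cfg : AS_family s G Z A.

Let AG := AS_sub cfg.
Let cA := AS_card cfg.
Let TI := AS_TI cfg.
Let ZG : Z \subset G := normal_sub (AS_normal cfg).

Lemma AS_ge2 : (2 <= s)%N.
Proof. by have := AS_even cfg; have := AS_pos cfg; case: (s) => [|[|]]. Qed.

Lemma AS_other (j : J) : exists i, i != j.
Proof.
have : (0 < #|[set~ j]|)%N by rewrite cardsC1 (AS_cardJ cfg) (AS_pos cfg).
by case/card_gt0P => i; rewrite !inE; exists i.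
Qed.

Lemma AS_TI1 i j x : i != j -> x \in A i -> x \in A j * Z -> x = 1.
Proof.
by move=> ij xi xj; apply/set1P/(subsetP (TI ij)); rewrite inE xi.
Qed.

Lemma AS_joinE j : A j <*> Z = A j * Z.
Proof. by apply: norm_joinEl; apply: subset_trans (AG j) (normal_norm (AS_normal cfg)). Qed.

Lemma AS_mulZ_sub j : A j * Z \subset G.
Proof. by rewrite mul_subG. Qed.

Lemma AS_sub_mulZ j : A j \subset A j * Z.
Proof. exact: mulG_subl. Qed.

Lemma AS_Zsub_mulZ j : Z \subset A j * Z.
Proof. exact: mulG_subr. Qed.

Lemma AS_TIZ j : A j :&: Z = 1.
Proof.
have [i ij] := AS_other j; apply/trivgP/subsetP => x /setIP[xj xZ].
rewrite eq_sym in ij; apply/set1P/(AS_TI1 ij xj).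
exact: (subsetP (AS_Zsub_mulZ i)).
Qed.

Lemma AS_card_mulZ j : #|(A j * Z)%g| = (s * #|Z|)%N.
Proof. by rewrite TI_cardMg ?AS_TIZ // cA. Qed.

Lemma AS_mulZr j g x : x \in A j * Z -> (g * x \in A j * Z) = (g \in A j * Z).
Proof. by rewrite -AS_joinE => xA; apply: (groupMr (G := [group of A j <*> Z])). Qed.

Lemma AS_mulZI i j g : i != j -> g \in A i * Z -> g \in A j * Z -> g \in Z.
Proof.
move=> ij /mulsgP[a u ai uZ ->]; have uj := subsetP (AS_Zsub_mulZ j) u uZ.
by rewrite AS_mulZr // => /(AS_TI1 ij ai) ->; rewrite mul1g.
Qed.

Lemma AS_gen i j : i != j -> A i * (A j * Z) = G.
Proof.
move=> ij; apply/eqP; rewrite eqEcard mul_subG ?AS_mulZ_sub //=.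
have TIij : A i :&: (A j <*> Z) = 1.
  by apply/eqP; rewrite eqEsubset sub1G AS_joinE TI.
by rewrite -AS_joinE TI_cardMg //= AS_joinE AS_card_mulZ cA (AS_cardG cfg); norm_card; lia.
Qed.

(** The s + 1 sets A_j Z minus Z are disjoint of size (s - 1)|Z|, and (s + 1)(s - 1)|Z| is exactly
    the size of G minus Z. *)
Lemma AS_cover_card g : g \in G -> g \notin Z -> #|[set j | g \in A j * Z]| = 1%N.
Proof.
have le1 h : h \notin Z -> (#|[set j | h \in A j * Z]%g| <= 1)%N.
  move=> hZ; rewrite leqNgt; apply/negP => /card_gt1P[i [j]].
  by rewrite !inE => -[hi hj ij]; case/negP: hZ; apply: AS_mulZI ij hi hj.
move=> gG gZ; apply/eqP; rewrite eqn_leq le1 //= lt0n; apply/negP => /eqP g0.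
have := double_count (G :\: Z) (fun j => A j * Z).
have gGZ : g \in G :\: Z by rewrite inE gZ.
rewrite (bigD1 g) //= g0 add0n => e.
have : (\sum_j #|((G :\: Z) :&: (A j * Z))%g| <= #|G :\: Z| - 1)%N.
  rewrite -e; apply: (@leq_trans (\sum_(h in G :\: Z | h != g) 1)).
    by apply: leq_sum => h /andP[/setDP[_ hZ] _]; apply: le1.
  rewrite sum1dep_card (cardsD1 g (G :\: Z)) gGZ add1n subn1 /=.
  rewrite subset_leq_card //; apply/subsetP => h /setIdP[hX hg].
  by rewrite in_setD1 hg.
have cj j : #|((G :\: Z) :&: (A j * Z))%g| = ((s - 1) * #|Z|)%N.
  rewrite setIDAC (setIidPr (AS_mulZ_sub j)).
  rewrite cardsD (setIidPr (AS_Zsub_mulZ j)) AS_card_mulZ; norm_card; nia.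
under eq_bigr do rewrite cj.
rewrite sum_nat_const (AS_cardJ cfg) cardsD (setIidPr ZG) (AS_cardG cfg).
have := cardG_gt0 Z; have := AS_ge2; norm_card; nia.
Qed.

Lemma AS_cover g : g \in G -> exists j, g \in A j * Z.
Proof.
move=> gG; case: (boolP (g \in Z)) => gZ.
  have : (0 < #|J|)%N by rewrite (AS_cardJ cfg).
  by case/card_gt0P => j _; exists j; apply: (subsetP (AS_Zsub_mulZ j)).
have : (0 < #|[set j | g \in A j * Z]%g|)%N by rewrite AS_cover_card.
by case/card_gt0P => j; rewrite inE; exists j.
Qed.

Lemma AS_notin g i j : i != j -> g \notin Z -> g \notin A i * Z \/ g \notin A j * Z.
Proof.
move=> ij gZ; case: (boolP (g \in A i * Z)) => gi; last by left.
by right; apply: contra gZ; apply: AS_mulZI ij gi.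
Qed.

(* A dual hyperoval property: if A_j lies in N, then counting the elements of
   the A_l in N through AS_adj leaves room for exactly one further A_l. *)
Lemma AS_hyper (N : {group gT}) i j k :
    N \subset G -> #|G| = (2 * #|N|)%N -> ~~ (Z \subset N) ->
    i != j -> i != k -> k != j ->
  A i \subset N -> A j \subset N -> A k \subset N -> False.
Proof.
move=> sNG cG nZN ij ik kj sAi sAj sAk.
set E := \bigcup_i A i; pose X := N :\: (A j * Z).
have Z0 := cardG_gt0 Z; have s2 := AS_ge2.
have hX : X * A j = X.
  apply/eqP; rewrite eqEsubset mulG_subl andbT; apply/subsetP.
  move=> _ /mulsgP[x a /setDP[xN xA] aj ->].
  have aA := subsetP (AS_sub_mulZ j) a aj; have aN := subsetP sAj a aj.
  by rewrite in_setD AS_mulZr // xA groupM.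
have eX : (#|E :&: X| * #|Z| = #|X|)%N.
  have := sum_card_lcosetI E hX => e; rewrite cA in e.
  have : (s * (#|E :&: X| * #|Z|) = s * #|X|)%N.
    rewrite mulnA -e big_distrl /= mulnC -sum_nat_const; apply: eq_bigr => g.
    by case/setDP => gN gA; apply: (AS_adj cfg) => //; apply: (subsetP sNG).
  by move/eqP; rewrite eqn_pmul2l ?(AS_pos cfg) // => /eqP.
(* N contains exactly half of A_j Z, because Z does not lie in N. *)
have cX : (2 * #|X| = s * (s - 1) * #|Z|)%N.
  have nA : ~~ (A j <*> Z \subset N).
    by apply: contra nZN; apply: subset_trans; apply: joing_subr.
  have sA : A j <*> Z \subset G by rewrite join_subG AG.
  have := index2_meet sA sNG cG nA.
  rewrite /= AS_joinE AS_card_mulZ setIC /X cardsD => e1.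
  by rewrite !mulnBr muln1 mulnBl -e1 -(AS_cardG cfg) cG.
have leE : (\sum_l #|(E :&: X) :&: A l| <= #|E :&: X|)%N.
  rewrite -double_count -sum1_card; apply: leq_sum => g /setIP[_ /setDP[_ gA]].
  rewrite leqNgt; apply/negP => /card_gt1P[l [m]]; rewrite !inE => -[gl gm lm].
  case/negP: gA; rewrite (AS_TI1 lm gl) ?(subsetP (AS_sub_mulZ m)) //.
  by rewrite (subsetP (AS_sub_mulZ j)).
have cl l : l != j -> #|(E :&: X) :&: A l| = (#|A l :&: N| - 1)%N.
  move=> lj; have -> : (E :&: X) :&: A l = (A l :&: N) :\ 1.
    apply/setP => g; apply/idP/idP.
      case/setIP => /setIP[_ /setDP[gN gA]] gl; rewrite in_setD1 inE gl gN !andbT.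
      by apply: contraNneq gA => ->; rewrite -AS_joinE group1.
    case/setD1P => g1 /setIP[gl gN]; rewrite !in_setI gl andbT in_setD gN andbT.
    apply/andP; split; first by apply/bigcupP; exists l.
    by apply: contra g1 => gA; rewrite (AS_TI1 lj gl gA).
  by rewrite (cardsD1 1 (A l :&: N)) inE !group1 add1n subn1.
have low l : (s <= 2 * #|A l :&: N|)%N.
  case: (boolP (A l \subset N)) => h.
    by rewrite (setIidPl h) cA; clear; lia.
  by rewrite -(cA l) -(index2_meet (AG l) sNG cG h).
have full l : A l \subset N -> #|A l :&: N| = s.
  by move=> h; rewrite (setIidPl h) cA.
(* A_i and A_k contribute s - 1 each, the s - 2 remaining components at least (s - 2) / 2 each.
   Twice the total is at least 4(s - 1) + (s - 2)^2 = s^2, more than the available s(s - 1). *)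
move: leE; rewrite (bigD1 j) //= (bigD1 i) //= (bigD1 k) /=; last first.
  by rewrite kj eq_sym.
rewrite (cl i) // (cl k) // !full //.
have : ((s - 2) * (s - 2) <= 2 * \sum_(l | (l != j) && (l != i) && (l != k))
          #|E :&: X :&: A l|)%N.
  rewrite big_distrr /=.
  apply: (@leq_trans (\sum_(l | (l != j) && (l != i) && (l != k)) (s - 2))).
    rewrite sum_nat_const leq_mul2r; apply/orP; right.
    have : #|[set l | (l != j) && (l != i) && (l != k)]| = (#|J| - 3)%N.
      have -> : [set l | (l != j) && (l != i) && (l != k)] = ~: [set j; i; k].
        by apply/setP => l; rewrite !inE !negb_or.
      rewrite cardsCs setCK -setUA cardsU1 cards2 !inE ik.
      by rewrite [j == i]eq_sym (negbTE ij) [j == k]eq_sym (negbTE kj).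
    by rewrite cardsE (AS_cardJ cfg) => ->; clear; lia.
  apply: leq_sum => l /andP[/andP[lj _] _]; rewrite cl //.
  by have := low l; clear; lia.
have : (2 * #|E :&: X| = s * (s - 1))%N.
  by apply/eqP; rewrite -(eqn_pmul2r Z0) -mulnA eX cX.
set t := (\sum_(_ | _) _)%N; set c := #|_ :&: A j|; set u := #|_|.
move: c t u; clear -s2 => c t u.
case: s s2 => [|[|m]] // _; rewrite !subSS !subn0 => h1 h2 h3.
have : (m.+2 * m.+1 = m * m + 3 * m + 2)%N by clear; nia.
by move: h1 h2 h3; clear; lia.
Qed.

End Family.

(** * The components A_j have exponent 2 *)

Section FamilyExponent.
Variables (gT : finGroupType) (J : finType) (s : nat).
Variables (G Z : {group gT}) (A : J -> {group gT}).
Hypothesis fam : AS_family s G Z A.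

Let AG := AS_sub fam.
Let cA := AS_card fam.

(* The A_j Z / Z form a spread of G / Z; a conjugate of an element of one
   component cannot lie in another one. *)
Lemma AS_mulZ_normal j b x : x \in G -> b \in A j * Z -> b ^ x \in A j * Z.
Proof.
move=> xG bA; have nZG := normal_norm (AS_normal fam).
have bG : b \in G := subsetP (AS_mulZ_sub fam j) b bA.
have [k bk] := AS_cover fam (groupJ bG xG).
have [<-//|kj] := eqVneq k j.
(* With x^-1 = v u, the element b ^ u^-1 lies in A_j Z and, since v normalizes A_k Z, also in A_k Z;
   hence it lies in Z, and so does b. *)
have : x^-1 \in A k * (A j * Z) by rewrite (AS_gen fam kj) groupV.
case/mulsgP => v u vA uA /(canRL invgK); rewrite invMg => ex.
have uG : u \in G := subsetP (AS_mulZ_sub fam j) u uA.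
have bu : b ^ u^-1 \in A j * Z.
  by move: bA uA; rewrite -(AS_joinE fam) => bA uA; rewrite groupJ ?groupV.
have buk : b ^ u^-1 \in A k * Z.
  have vZ : v \in A k * Z := subsetP (AS_sub_mulZ Z A k) v vA.
  move: bk vZ; rewrite ex conjgM -(AS_joinE fam) => bk vZ.
  by rewrite -(memJ_conjg _ v^-1) conjGid ?groupV.
have := AS_mulZI fam kj buk bu.
rewrite memJ_norm ?(subsetP nZG) ?groupV // => bZ.
by apply: (subsetP (AS_Zsub_mulZ Z A j)); rewrite memJ_norm ?(subsetP nZG).
Qed.

(** A_i Z and A_j Z are normal in G and meet in Z. *)
Lemma AS_comm_Z i j x y :
  i != j -> x \in A i -> y \in A j -> [~ x, y] \in Z.
Proof.
move=> ij xA yA; have xG := subsetP (AG i) x xA; have yG := subsetP (AG j) y yA.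
have xi := subsetP (AS_sub_mulZ Z A i) x xA.
have yj := subsetP (AS_sub_mulZ Z A j) y yA.
apply: (AS_mulZI fam ij).
  have := AS_mulZ_normal yG xi; move: xi; rewrite -(AS_joinE fam) => xi xyi.
  by rewrite commgEl groupM ?groupV.
have := AS_mulZ_normal xG yj; move: yj; rewrite -(AS_joinE fam) => yj yxj.
by rewrite commgEr conjVg groupM ?groupV.
Qed.

(** For b in A_j, ab lies in some A_k Z with k different from j. Since (ab)^2 is b^2 times an
    element of Z, b^2 lies in both A_j and A_k Z, hence is 1. *)
Lemma AS_exp2_step i j a :
  i != j -> a \in A i -> a != 1 -> a ^+ 2 = 1 -> exp2 (A j).
Proof.
move=> ij aA a1 a2 b bA; have aG := subsetP (AG i) a aA.
have bG := subsetP (AG j) b bA.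
have [k abk] := AS_cover fam (groupM aG bG).
have bj := subsetP (AS_sub_mulZ Z A j) b bA.
have jk : j != k.
  apply: contra a1 => /eqP jk; rewrite -jk in abk.
  by rewrite (AS_mulZr fam) // in abk; apply/eqP/(AS_TI1 fam ij aA).
apply: (AS_TI1 fam jk); first exact: groupX.
have cZ : [~ b, a] \in Z by rewrite (AS_comm_Z _ bA aA) // eq_sym.
have : (a * b) ^+ 2 \in A k * Z.
  by move: abk; rewrite -(AS_joinE fam) => abk; rewrite groupX.
have -> : (a * b) ^+ 2 = b ^+ 2 * [~ b, a] ^ b.
  rewrite !expg2 -mulgA [b * (a * b)]mulgA (commgC b a) !mulgA.
  rewrite -[a * a]/(a ^+ 2) a2 mul1g.
  by rewrite mulgK.
rewrite (AS_mulZr fam) //; apply: (subsetP (AS_Zsub_mulZ Z A k)).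
by rewrite memJ_norm // (subsetP (normal_norm (AS_normal fam))).
Qed.

(** Since s is even, another component contains an involution, to which [AS_exp2_step] applies. *)
Lemma AS_family_exp2 j : exp2 (A j).
Proof.
have [i ij] := AS_other fam j.
have inv k : (exists2 a, a \in A k & a != 1 /\ a ^+ 2 = 1).
  have : 2 %| #|A k| by rewrite cA dvdn2 (AS_even fam).
  case/(Cauchy (isT : prime 2)) => a aA oa; exists a => //.
  by split; [apply/eqP => e; move: oa; rewrite e order1 | rewrite -oa expg_order].
by have [a aA [a1 a2]] := inv i; apply: (AS_exp2_step ij aA).
Qed.

Lemma AS_family_config : #|Z| = s -> AS_config s G Z A.
Proof.
move=> cZ; split=> //; last exact: AS_family_exp2.
have [j _] : exists j : J, True.
  have /card_gt0P[j _] : (0 < #|J|)%N by rewrite (AS_cardJ fam).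
  by exists j.
have ab : 2.-abelem (A j).
  by apply/exponent2_abelem/exponentP => x /AS_family_exp2.
have := abelem_pgroup ab; rewrite /pgroup cA (AS_cardG fam) cZ => s2.
by rewrite !pnatM s2.
Qed.

End FamilyExponent.

Section Key.
Variables (gT : finGroupType) (J : finType) (s : nat).
Variables (G Z : {group gT}) (A : J -> {group gT}).
Hypothesis cfg : AS_config s G Z A.

(** By [AS_adj] the coset g A_j contains an element ga of some A_i; as g and a commute, 1 = (ga)^2 =
    g^2. *)
Lemma AS_key j g : g \in 'C_G(A j) -> g \notin A j * Z -> g ^+ 2 = 1.
Proof.
case/setIP => gG gC gA; have := AS_adj cfg gG gA.
have [|] := posnP #|(g *: A j) :&: \bigcup_i A i|.
  by move=> -> e; have := AS_pos cfg; rewrite -e.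
case/card_gt0P => e /setIP[/lcosetP[a aj ->] /bigcupP[i _ ei]] _.
have ca : commute g a by apply: (centP gC).
by have := AS_exp2 cfg ei; rewrite expgMn // (AS_exp2 cfg aj) mulg1.
Qed.

End Key.

(** * Noncentral Z *)

Section Class2.
Variables (gT : finGroupType) (J : finType) (s : nat).
Variables (G Z : {group gT}) (A : J -> {group gT}) (z : gT).
Hypothesis cfg : AS_config s G Z A.
Hypotheses (zZ : z \in Z) (zR : z \in 'Z(G)) (z1 : z != 1).
Hypothesis hz : {in G &, forall x y, x ^ y \in [set x; x * z]}.

Let AG := AS_sub cfg.
Let cA := AS_card cfg.
Let ZG : Z \subset G := normal_sub (AS_normal cfg).
Let eA j : exp2 (A j) := @AS_exp2 _ _ _ _ _ _ cfg j.
Let abA j : A j \subset 'C(A j) := exp2_abelian (@eA j).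

Lemma AS_dual (X : {group gT}) :
  X \subset G -> (#|G| * #|X :&: 'Z(G)| = #|X| * #|'C_G(X)|)%N.
Proof.
move=> sXG; rewrite -(@cent_duality _ z X G).
- by congr (_ * #|_|)%N; rewrite setIA (setIidPl sXG).
- by move=> x y xX yG; apply: hz => //; apply: (subsetP sXG).
- by move=> y x yG xX; apply: hz => //; apply: (subsetP sXG).
Qed.

(** The bound on totally isotropic subgroups for the commutator form: X lies in C_G(X), whose order
    is given by duality. *)
Lemma AS_abelian_bound (X : {group gT}) :
  X \subset G -> abelian X -> (#|X| * #|X| <= #|G| * #|'Z(G)|)%N.
Proof.
move=> sXG abX; apply: (@leq_trans (#|X| * #|'C_G(X)|)%N).
  by rewrite leq_mul2l subset_leq_card ?orbT // subsetI sXG.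
by rewrite -AS_dual // leq_mul2l subset_leq_card ?orbT // subsetIr.
Qed.

Lemma AS_card_cent j : (#|'C_G(A j)| = s * #|Z| * #|A j :&: 'Z(G)|)%N.
Proof.
have := AS_dual (AG j); rewrite cA (AS_cardG cfg) -!mulnA => /eqP.
by rewrite eqn_pmul2l ?(AS_pos cfg) // => /eqP <-.
Qed.

Lemma AS_cent1_half v : v \in G -> v \notin 'Z(G) -> #|G| = (2 * #|'C_G[v]|)%N.
Proof.
move=> vG vR; rewrite (@cent1_class2_index _ z) => [|y yG]; last exact: hz.
by case: ifP => // vC; rewrite inE vG vC in vR.
Qed.

Lemma AS_subcent1 v j : (A j \subset 'C_G[v]) = (v \in 'C(A j)).
Proof. by rewrite subsetI AG sub_cent1. Qed.

Lemma AS_cent_uniq v i j :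
  v \in 'C_G(Z) -> i != j -> v \in 'C(A i) -> v \in 'C(A j) -> v \in 'Z(G).
Proof.
case/setIP => vG vZ ij vi vj; rewrite inE vG /=.
rewrite -sub_cent1 -(AS_gen cfg ij) !mul_subG //.
- by rewrite sub_cent1.
- by rewrite sub_cent1.
- by rewrite sub_cent1.
Qed.

(** If v centralizes Z, two such A_j together with Z generate G. Otherwise C_G(v) has index 2 and
    does not contain Z, so [AS_hyper] excludes three. *)
Lemma AS_cent_le2 v :
  v \in G -> v \notin 'Z(G) -> (#|[set j | v \in 'C(A j)]| <= 2)%N.
Proof.
move=> vG vR; rewrite leqNgt; apply/negP => /card_gt2P[i [j [k]]].
rewrite !inE => -[[vi vj vk] [ij jk ki]].
case: (boolP (v \in 'C(Z))) => vZ.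
  by case/negP: vR; apply: (AS_cent_uniq _ ij vi vj); rewrite inE vG.
have nZ : ~~ (Z \subset 'C_G[v]).
  by rewrite subsetI ZG sub_cent1.
rewrite eq_sym in ki; rewrite eq_sym in jk.
by apply: (AS_hyper cfg (subsetIl G 'C[v]) (AS_cent1_half vG vR) nZ ij ki jk);
  rewrite AS_subcent1.
Qed.

(** Otherwise N = C_G(v), of index 2 and containing Z, meets every A_j Z in index 2. Twice the order
    of N minus Z would then be both (s^2 - 2)|Z| and (s + 1)(s - 2)|Z|. *)
Lemma AS_cent_ex v :
  v \in 'C_G(Z) -> v \notin 'Z(G) -> exists j, v \in 'C(A j).
Proof.
case/setIP => vG vZ vR; apply/existsP; apply: contraT.
rewrite negb_exists => /forallP none.
pose N := 'C_G[v]; have cG : #|G| = (2 * #|N|)%N := AS_cent1_half vG vR.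
have sZN : Z \subset N by rewrite subsetI ZG sub_cent1.
have sNG : N \subset G := subsetIl _ _.
have := double_count (N :\: Z) (fun j => A j * Z).
rewrite (eq_bigr (fun=> 1%N)); last first.
  by move=> g /setDP[gN gZ]; apply: (AS_cover_card cfg) => //; apply: (subsetP sNG).
have cj j : (2 * #|(N :\: Z) :&: (A j * Z)%g| = (s - 2) * #|Z|)%N.
  have sAZ : A j <*> Z \subset G by rewrite (AS_joinE cfg) (AS_mulZ_sub cfg).
  have nAZ : ~~ (A j <*> Z \subset N).
    by rewrite join_subG AS_subcent1 (negbTE (none j)).
  have := index2_meet sAZ sNG cG nAZ.
  have eZ : N :&: (A j * Z) :&: Z = Z.
    by apply/setIidPr; rewrite subsetI sZN AS_Zsub_mulZ.
  rewrite /= (AS_joinE cfg) (AS_card_mulZ cfg) setIDAC cardsD eZ setIC => e.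
  by rewrite mulnBr e mulnBl.
rewrite sum1_card cardsD (setIidPr sZN) => e.
have : (2 * \sum_j #|(N :\: Z) :&: (A j * Z)%g| = s.+1 * ((s - 2) * #|Z|))%N.
  rewrite big_distrr /=; under eq_bigr do rewrite cj.
  by rewrite sum_nat_const (AS_cardJ cfg).
rewrite -e mulnBr -cG (AS_cardG cfg).
have := cardG_gt0 Z; have := AS_ge2 cfg; set w := #|Z|; clear.
case: s => [|[|m]] // _ w0; rewrite !subSS subn0.
by have : (m.+2 * m.+2 * w - 2 * w = m * m * w + 4 * m * w + 2 * w)%N; nia.
Qed.

(** Of two components A_i Z and A_j Z at least one misses v, so [AS_key] applies. *)
Lemma AS_center_out v : v \in 'Z(G) -> v \notin Z -> v ^+ 2 = 1.
Proof.
case/centerP => vG vC vZ.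
have /card_gt0P[i _] : (0 < #|J|)%N by rewrite (AS_cardJ cfg).
have [j ji] := AS_other cfg i.
have h k : v \in 'C_G(A k).
  by rewrite inE vG; apply/centP => x /(subsetP (AG k)); apply: vC.
by case: (AS_notin cfg ji vZ); apply: (AS_key cfg (h _)).
Qed.

Section NonCentral.
Hypothesis nZR : ~~ (Z \subset 'Z(G)).
Local Notation R := 'Z(G).

Lemma zIR : z \in Z :&: R. Proof. by rewrite inE zZ. Qed.

Lemma AS_ZIR_ge2 : (2 <= #|Z :&: R|)%N.
Proof.
have : [set 1; z] \subset Z :&: R.
  by apply/subsetP => x /set2P[]->; [apply: group1 | apply: zIR].
by move/subset_leq_card; rewrite cards2 eq_sym z1.
Qed.

(** If each A_j were centralized by some v in Z minus R, then also by vz, giving at least 2(s + 1)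
    incidences; [AS_cent_le2] allows at most 2|Z minus R| <= 2(s - 2). *)
Lemma AS_good_index : exists i, 'C_Z(A i) \subset R.
Proof.
apply/existsP; apply: contraT; rewrite negb_exists => /forallP bad.
have := double_count (Z :\: R) (fun j => 'C(A j)).
have : (\sum_(v in Z :\: R) #|[set j | v \in 'C(A j)]| <= 2 * #|Z :\: R|)%N.
  rewrite mulnC -sum_nat_const; apply: leq_sum => v /setDP[vZ vR].
  by apply: AS_cent_le2 => //; apply: (subsetP ZG).
move=> le /esym e; move: le; rewrite -{}e.
have low j : (2 <= #|(Z :\: R) :&: 'C(A j)|)%N.
  have /subsetPn[v /setIP[vZ vC] vR] := bad j.
  have vz : v != v * z by rewrite -{1}[v]mulg1 (inj_eq (mulgI v)) eq_sym.
  suff : [set v; v * z] \subset (Z :\: R) :&: 'C(A j).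
    by move/subset_leq_card; rewrite cards2 vz.
  have zC : z \in 'C(A j) by apply: (subsetP (centS (AG j))); case/setIP: zR.
  apply/subsetP => x /set2P[]->; first by rewrite in_setI in_setD vR vZ.
  by rewrite in_setI in_setD groupMr // vR !groupM.
have : (#|J| * 2 <= \sum_j #|(Z :\: R) :&: 'C(A j)|)%N.
  by rewrite -sum_nat_const; apply: leq_sum => j _; apply: low.
rewrite (AS_cardJ cfg) cardsD.
have := AS_ZIR_ge2; have := AS_leZ cfg; have := AS_pos cfg.
by set u := (\sum_j _)%N; norm_card; move: u; clear; lia.
Qed.

Lemma AS_mem_centA v j : v \in A j -> v \in 'C(A j).
Proof. by move=> vA; apply: (subsetP (abA j)). Qed.

Lemma AS_mul_center_sub j : A j * R \subset 'C_G(A j).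
Proof.
have sRC : R \subset 'C(A j).
  by apply: subset_trans (centS (AG j)); apply: subsetIr.
by rewrite mul_subG // subsetI ?AG ?abA ?center_sub.
Qed.

Lemma AS_cent_small_center j :
  (s * #|R| <= #|'C_G(A j)| * #|A j :&: R|)%N.
Proof.
have := mul_cardG (A j) 'Z(G); rewrite cA => ->.
by rewrite leq_mul2r subset_leq_card ?orbT // AS_mul_center_sub.
Qed.

(* For the index i of AS_good_index, C_G(A_i) meets A_i Z in a central
   subgroup and has exponent 2 off it, so it is abelian; being self-dual it
   forces the size of the center. *)
Lemma AS_card_center : exists i, #|R| = (#|Z| * (#|A i :&: R| * #|A i :&: R|))%N.
Proof.
have [i sCR] := AS_good_index; exists i.
have comm_in x y : x \in A i * Z -> x \in 'C_G(A i) -> y \in 'C_G(A i) -> commute x y.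
  case/mulsgP => a v ai vZ -> /setIP[_ avC] /setIP[yG yC].
  have vR : v \in R.
    apply: (subsetP sCR); rewrite inE vZ /=.
    by move: avC; rewrite groupMl // AS_mem_centA.
  apply: commute_sym; apply: commuteM; first exact: (centP yC).
  by apply: commute_sym; case/centerP: vR => _; apply.
have abC : abelian 'C_G(A i).
  apply/centsP => x xC y yC.
  case: (boolP (x \in A i * Z)) => xA; first exact: comm_in.
  case: (boolP (y \in A i * Z)) => yA; first exact/commute_sym/comm_in.
  (* If x, y and xy all lie outside A_i Z they are involutions, hence x and y commute; otherwise xy
     commutes with x. *)
  case: (boolP (x * y \in A i * Z)) => xyA; last first.
    by apply: expg2_commute; apply: (AS_key cfg (j := i)) => //; apply: groupM.
  have cxy : commute (x * y) x by apply: comm_in; rewrite ?groupM.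
  by apply: (mulgI x); rewrite [RHS]mulgA; apply: esym.
have := AS_abelian_bound (subsetIl G 'C(A i)) abC.
rewrite AS_card_cent.
have := AS_cent_small_center i; rewrite AS_card_cent (AS_cardG cfg).
have a0 : (0 < #|A i :&: R|)%N by apply: cardG_gt0.
have := cardG_gt0 Z; have := AS_pos cfg.
set a := #|A i :&: R| in a0 *; set w := #|Z|.
norm_card; set r := #|R|; move: a a0 w r; clear => a a0 w r s0 w0 le1 le2.
have {}le1 : (r <= w * (a * a))%N.
  by rewrite -(leq_pmul2l s0); apply: (leq_trans le1); rewrite !mulnA.
have {}le2 : (w * (a * a) <= r)%N.
  have p0 : (0 < s * s * w)%N by rewrite !muln_gt0 s0 w0.
  by rewrite -(leq_pmul2l p0); apply: leq_trans le2; clear; nia.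
by apply/eqP; rewrite eqn_leq le1 le2.
Qed.

(** By [AS_card_center], |R| >= |Z|, so R has an element u outside Z. For v in both R and Z, u and
    vu lie in R outside Z, hence have square 1. *)
Lemma AS_center_exp2 : exp2 R.
Proof.
have [i e] := AS_card_center.
have [u uR uZ] : exists2 u, u \in R & u \notin Z.
  apply/subsetPn; apply: contra nZR => sRZ.
  suff -> : Z = 'Z(G) :> {set gT} by [].
  apply/eqP; rewrite eq_sym eqEcard sRZ e /=.
  by rewrite leq_pmulr // muln_gt0 andbb cardG_gt0.
move=> v vR; case: (boolP (v \in Z)) => vZ; last exact: AS_center_out.
have : (v * u) ^+ 2 = 1.
  by apply: AS_center_out; [apply: groupM | rewrite groupMl].
rewrite expgMn; last by case/centerP: vR => vG; apply; case/centerP: uR.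
by rewrite (AS_center_out uR uZ) mulg1.
Qed.

Lemma AS_cent_exp2_eq j :
  (s * #|R| = #|'C_G(A j)| * #|A j :&: R|)%N -> exp2 'C_G(A j).
Proof.
move=> e; suff <- : A j * R = 'C_G(A j).
  apply: exp2_mulg (@eA j) AS_center_exp2 _.
  by rewrite centsC; apply: subset_trans (centS (AG j)); apply: subsetIr.
apply/eqP; rewrite eqEcard AS_mul_center_sub /=.
have := mul_cardG (A j) 'Z(G); rewrite cA e => /eqP.
by rewrite eqn_pmul2r ?cardG_gt0 // => /eqP ->.
Qed.

Lemma AS_cent_exp2_big j :
  (2 * #|'C_G(A j) :&: (A j * Z)%g| < #|'C_G(A j)|)%N -> exp2 'C_G(A j).
Proof.
rewrite -(AS_joinE cfg) => h; apply: exp2_outside h => x /setDP[xC xA].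
by apply: (AS_key cfg xC); rewrite -(AS_joinE cfg).
Qed.

(* Otherwise every C_G(A_j) has exponent 2, and these centralizers cover more
   than 3/4 of G. *)
Lemma AS_card_center_eq : #|R| = #|Z|.
Proof.
have [i e] := AS_card_center; move: e.
have a0 : (0 < #|A i :&: R|)%N by apply: cardG_gt0.
have ai : (#|A i :&: R| <= s)%N by rewrite -(cA i) subset_leq_card ?subsetIl.
have w0 := cardG_gt0 Z; have s0 := AS_pos cfg.
case: (leqP #|A i :&: R| 1) => [a1|a2] e.
  have {}a1 : #|A i :&: R| = 1%N by apply/eqP; rewrite eqn_leq a1.
  by rewrite e a1 !muln1.
(* Let a and b be the orders of the meets of A_i and A_j with R. If half of C_G(A_j) or more lies in
   A_j Z, then b <= 2; as a >= 2 and a^2 <= b^2, a = b = 2, the equality case [AS_cent_exp2_eq]. *)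
have C2 j : exp2 'C_G(A j).
  case: (ltnP (2 * #|'C_G(A j) :&: (A j * Z)%g|) #|'C_G(A j)|) => [|le].
    exact: AS_cent_exp2_big.
  apply: AS_cent_exp2_eq; rewrite AS_card_cent e.
  have := AS_cent_small_center j; rewrite AS_card_cent e.
  have := leq_trans le (_ : _ <= 2 * (s * #|Z|))%N.
  rewrite AS_card_cent -(AS_card_mulZ cfg j) leq_mul2l subset_leq_card ?subsetIr //.
  move/(_ isT); rewrite (AS_card_mulZ cfg).
  move: a2; set a := #|A i :&: R|; set b := #|A j :&: R|; set w := #|Z| in w0 *.
  move: w0 s0; clear; move: a b w => a b w w0 s0 a2 le1 le2.
  have p0 : (0 < s * w)%N by rewrite muln_gt0 s0.
  have b2 : (b <= 2)%N by rewrite -(leq_pmul2l p0) [(_ * 2)%N]mulnC.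
  have ab : (a * a <= b * b)%N.
    by rewrite -(leq_pmul2l p0) -mulnA; apply: leq_trans le2 _; rewrite -!mulnA.
  have [-> ->] : a = 2 /\ b = 2 by move: a2 b2 ab; clear; nia.
  by rewrite !mulnA.
case/negP: nZR; apply: subset_trans ZG _.
suff abG : abelian G by rewrite subsetI subxx.
apply: exp2_three_quarters.
set I := [set x in G | _]; have sIG : I \subset G by apply/subsetP => x /setIdP[].
have sRI : R \subset I.
  apply/subsetP => x xR; rewrite inE (subsetP (center_sub G)) //=.
  by apply/eqP/AS_center_exp2.
have := double_count (I :\: R) (fun j => 'C_G(A j)).
have cj j : #|(I :\: R) :&: 'C_G(A j)| = (#|'C_G(A j)| - #|R|)%N.
  have sCI : 'C_G(A j) \subset I.
    apply/subsetP => x xC; apply/setIdP.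
    by split; [case/setIP: xC | apply/eqP/(C2 j)].
  have sRC : R \subset 'C_G(A j).
    by rewrite subsetI center_sub; apply: subset_trans (centS (AG j)); apply: subsetIr.
  by rewrite setIDAC (setIidPr sCI) cardsD (setIidPr sRC).
under [X in _ = X]eq_bigr do rewrite cj.
have : (\sum_(g in I :\: R) #|[set j | g \in 'C_G(A j)]| <= 2 * #|I :\: R|)%N.
  rewrite mulnC -sum_nat_const; apply: leq_sum => v /setDP[vI vR].
  have vG := subsetP sIG v vI; apply: leq_trans (AS_cent_le2 vG vR).
  by apply: subset_leq_card; apply/subsetP => j; rewrite !inE => /andP[].
move=> le eq; move: le; rewrite {}eq cardsD (setIidPr sRI) => le.
have := leq_trans (_ : #|J| * (s * #|Z| * #|A i :&: R| - #|R|) <= _)%N le.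
rewrite -sum_nat_const leq_sum => [/(_ isT)|j _]; last first.
  rewrite AS_card_cent leq_sub2r // leq_mul2l; apply/orP; right.
  have := AS_cent_small_center j; rewrite AS_card_cent e.
  move: w0 s0; clear; set a := #|_|; set b := #|A j :&: R|; set w := #|Z| => w0 s0.
  have p0 : (0 < s * w)%N by rewrite muln_gt0 s0.
  rewrite -!mulnA mulnA [(s * (w * _))%N]mulnA leq_pmul2l //; nia.
rewrite sum_nat_const (AS_cardJ cfg) (AS_cardG cfg).
have := subset_leq_card sRI; rewrite e; move: w0 a2 ai; clear.
set a := #|_ :&: R|; set w := #|Z|; norm_card; set u := #|I|.
move: a w u => a w u w0 a2 ai le1 le2.
(* The count gives 4|I| - 3|G| >= |Z| (a^2 + 2at(a - 2) + t^2(2a - 3)), which is positive because a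
   >= 2. *)
have [t es] : exists t, s = (a + t)%N by exists (s - a)%N; lia.
have [b ea] : exists b, a = (b + 2)%N by exists (a - 2)%N; lia.
have {}le2 : ((s + 1) * (w * a * t) + 2 * (w * (a * a)) <= 2 * u)%N.
  have : (s * w * a - w * (a * a) = w * a * t)%N by rewrite es; nia.
  by move=> E; rewrite E in le2; nia.
by rewrite es ea in le2 *; nia.
Qed.

Lemma AS_cent_TI_exp2 j : #|A j :&: R| = 1%N -> exp2 'C_G(A j).
Proof.
move=> a1; apply: AS_cent_exp2_eq.
by rewrite AS_card_cent AS_card_center_eq a1 !muln1.
Qed.

(** C_G(A_j) is too large to be abelian, so by [exp2_outside] at least half of it lies in A_j Z,
    which forces it to contain A_j Z. An element of it outside A_j Z inverts Z, so Z is abelian. *)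
Lemma AS_exceptional j :
  #|A j :&: R| != 1%N -> Z \subset 'C(A j) /\ abelian Z.
Proof.
move=> a1; have a2 : (2 <= #|A j :&: R|)%N.
  by rewrite ltn_neqAle eq_sym a1 cardG_gt0.
have p0 : (0 < s * #|Z|)%N by rewrite muln_gt0 (AS_pos cfg) cardG_gt0.
case: (ltnP (2 * #|'C_G(A j) :&: (A j * Z)%g|) #|'C_G(A j)|) => [lt|le].
  have := AS_abelian_bound (subsetIl G 'C(A j)) (exp2_abelian (AS_cent_exp2_big lt)).
  rewrite AS_card_cent AS_card_center_eq (AS_cardG cfg).
  have -> : (s * s * #|Z| * #|Z| = s * #|Z| * (s * #|Z|))%N.
    by rewrite mulnACA mulnA.
  move: p0 a2; clear.
  move: (s * #|Z|)%N #|_ :&: R| => p a p0 a2.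
  rewrite mulnACA -{2}[(p * p)%N]muln1 leq_pmul2l ?muln_gt0 ?p0 // => le.
  by exfalso; nia.
have sC : A j * Z \subset 'C_G(A j).
  apply/setIidPr/eqP; rewrite eqEcard subsetIr /=.
  rewrite -(leq_pmul2l (isT : 0 < 2)%N); apply: leq_trans le.
  by rewrite AS_card_cent (AS_card_mulZ cfg) mulnC leq_mul2l a2 orbT.
have sZC : Z \subset 'C_G(A j) := subset_trans (AS_Zsub_mulZ Z A j) sC.
split; first by apply: subset_trans sZC (subsetIr _ _).
have [x xC xA] : exists2 x, x \in 'C_G(A j) & x \notin A j * Z.
  apply/subsetPn; apply/negP => /subset_leq_card.
  rewrite AS_card_cent (AS_card_mulZ cfg).
  by move: p0 a2; clear; move: (s * #|Z|)%N #|_ :&: R| => p a; nia.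
have inv v : v \in Z -> v ^ x = v^-1.
  move=> vZ; have vA := subsetP (AS_Zsub_mulZ Z A j) v vZ.
  have x2 : x ^+ 2 = 1 := AS_key cfg xC xA.
  have : (x * v) ^+ 2 = 1.
    apply: (AS_key cfg (j := j)); first by rewrite groupM // (subsetP sZC).
    by apply: contra xA => h; rewrite -(AS_mulZr cfg _ vA).
  move/expg2_inv; rewrite invMg conjgE (expg2_inv x2) => e.
  by rewrite mulgA -e -mulgA -expg2 x2 mulg1.
apply/centsP => u uZ v vZ; apply: invg_inj.
by rewrite -inv ?groupM // conjMg !inv // invMg.
Qed.

(** A noncentral element of C_G(Z) centralizes some A_j and is an involution unless A_j meets R
    nontrivially and the element lies in A_j Z. Two such j would make Z central, so at most one A_j
    Z remains to be treated. *)
Lemma AS_centZ_exp2 : exp2 'C_G(Z).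
Proof.
pose D := 'C_G(Z).
have out v : v \in D -> (forall j, v \in 'C(A j) -> #|A j :&: R| != 1%N ->
    v \notin A j * Z) -> v ^+ 2 = 1.
  move=> vD h; case: (boolP (v \in R)) => vR; first exact: AS_center_exp2.
  have vG : v \in G by case/setIP: vD.
  have [j vj] := AS_cent_ex vD vR.
  have vC : v \in 'C_G(A j) by rewrite inE vG.
  case: (eqVneq #|A j :&: R| 1%N) => [a1|a1]; first exact: (AS_cent_TI_exp2 a1).
  by apply: (AS_key cfg vC); apply: h.
move=> v vD; case: (boolP [exists j, (#|A j :&: R| != 1%N) && (v \in A j * Z)]);
  last first.
  rewrite negb_exists => /forallP h; apply: out => // j _ a1.
  by have := h j; rewrite a1.
case/existsP => j /andP[a1 vA]; have [sZC abZ] := AS_exceptional a1.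
have [y yZ yR] := subsetPn nZR.
have yD : y \in D by rewrite inE (subsetP ZG) //; apply: (subsetP abZ).
have uniq k : #|A k :&: R| != 1%N -> k = j.
  move=> ak; have [sZk _] := AS_exceptional ak; apply: contraNeq yR => kj.
  by apply: (AS_cent_uniq yD kj); [apply: (subsetP sZk) | apply: (subsetP sZC)].
have outj x : x \in D -> x \notin A j * Z -> x ^+ 2 = 1.
  by move=> xD xA; apply: out => // k _ /uniq ->.
(* By duality |D| is s^2 times the order of the meet of Z and R, so |D| >= 2s^2 > s|Z|. Comparing
   the squares of x and xu then gives u^2 = 1. *)
have [x xD xA] : exists2 x, x \in D & x \notin A j * Z.
  apply/subsetPn; apply/negP => /subset_leq_card; rewrite (AS_card_mulZ cfg).
  have := AS_dual ZG; rewrite (AS_cardG cfg) -/D.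
  have := AS_ZIR_ge2; have := cardG_gt0 Z; have := AS_leZ cfg; have := AS_pos cfg.
  set d := #|D|; set w := #|Z|; set c := #|Z :&: R|; clear => s0 le w0 c2 e.
  have {}e : (s * s * c = d)%N.
    by apply/eqP; rewrite -(eqn_pmul2l w0) -e; apply/eqP; nia.
  by nia.
case/mulsgP: vA => a u aA uZ ->.
have u2 : u ^+ 2 = 1.
  have uA := subsetP (AS_Zsub_mulZ Z A j) u uZ.
  have cux : commute x u by case/setIP: xD => _ /centP; apply.
  have : (x * u) ^+ 2 = 1.
    apply: outj; last by rewrite (AS_mulZr cfg).
    rewrite groupM // inE (subsetP ZG) //; exact: (subsetP abZ).
  by rewrite expgMn // (outj x xD xA) mul1g.
apply: expg2M u2; last exact: eA aA.
by apply: commute_sym; apply: (centP (subsetP sZC u uZ)).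
Qed.

(** C_G(Z) is abelian of order greater than s|Z|, whereas [AS_abelian_bound] bounds the square of
    its order by s^2 |Z|^2. *)
Lemma AS_noncentral : False.
Proof.
have := AS_abelian_bound (subsetIl G 'C(Z)) (exp2_abelian AS_centZ_exp2).
have := AS_dual ZG; rewrite AS_card_center_eq (AS_cardG cfg).
have := AS_ZIR_ge2; have := cardG_gt0 Z; have := AS_leZ cfg; have := AS_pos cfg.
set d := #|'C_G(Z)|; set w := #|Z|; set c := #|Z :&: R|; clear => s0 le w0 c2 e.
have {}e : (s * s * c = d)%N.
  by apply/eqP; rewrite -(eqn_pmul2l w0) -e; apply/eqP; nia.
have lt : (s * w < d)%N by rewrite -e; nia.
by have := ltn_mul lt lt; rewrite mulnACA mulnA ltnNge => /negP.
Qed.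

End NonCentral.
End Class2.

(** * Central Z *)

Section Idempotent.
Import GRing.Theory.
Local Open Scope ring_scope.

(** In the rank factorization P = C W, idempotence gives W C = 1, and P has the same trace as W
    C. *)
Lemma mxtrace_idem (F : fieldType) n (P : 'M[F]_n) :
  P *m P = P -> \tr P = (\rank P)%:R.
Proof.
set C := col_base P; set W := row_base P; have eP : C *m W = P := mulmx_base P.
move=> idP; have : C *m (W *m (C *m W)) = C *m W by rewrite eP mulmxA eP idP.
move/(row_full_inj (col_base_full P)).
rewrite mulmxA -[RHS]mul1mx => /(row_free_inj (row_base_free P)) eWC.
by rewrite -{1}eP mxtrace_mulC eWC mxtrace1.
Qed.

End Idempotent.

Section Central.
Variables (gT : finGroupType) (J : finType) (s : nat).
Variables (G Z : {group gT}) (A : J -> {group gT}) (z : gT).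
Hypothesis cfg : AS_config s G Z A.
Hypotheses (zZ : z \in Z) (zR : z \in 'Z(G)) (z1 : z != 1) (z2 : z ^+ 2 = 1).
Hypothesis hz : {in G &, forall x y, x ^ y \in [set x; x * z]}.
Hypothesis ZR : Z \subset 'Z(G).

Let AG := AS_sub cfg.
Let cA := AS_card cfg.
Let ZG : Z \subset G := normal_sub (AS_normal cfg).

(** If v is central outside Z, then v and vu have square 1 for every u in Z, so Z has exponent 2. *)
Lemma AS_central_ZE : ~ exp2 Z -> 'Z(G) = Z.
Proof.
move=> nZ; apply/eqP; rewrite eqEsubset ZR andbT.
apply: contraT => /subsetPn[v vR vZ]; case: nZ => u uZ.
have : (v * u) ^+ 2 = 1.
  by apply: (AS_center_out cfg); [rewrite groupM // (subsetP ZR) | rewrite groupMr].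
rewrite expgMn; last by case/centerP: vR => _; apply; apply: (subsetP ZG).
by rewrite (AS_center_out cfg vR vZ) mul1g.
Qed.

Lemma AS_central_exp2Z : exp2 Z -> exp2 G.
Proof.
move=> eZ g gG; have [j /mulsgP[a u aA uZ ->]] := AS_cover cfg gG.
apply: expg2M (AS_exp2 cfg aA) (eZ u uZ).
by case/centerP: (subsetP ZR u uZ) => _ c; apply/commute_sym/c/(subsetP (AG j)).
Qed.

Import GRing.Theory Num.Theory.
Local Open Scope ring_scope.

Lemma AS_central_contra : ~ exp2 Z -> False.
Proof.
move=> nZ; have eZ := AS_central_ZE nZ.
have [i zi] : exists i : Iirr G, z \notin cfker 'chi_i.
  apply/existsP; rewrite -negb_forall; apply: contra z1 => /forallP h.
  by rewrite -in_set1 -set1gE -(TI_cfker_irr G); apply/bigcapP => i _.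
have zG := subsetP ZG z zZ.
pose rG := 'Chi_i; pose d := irr_degree (socle_of_Iirr i).
have [c rz] : exists c, rG z = c%:M.
  have : z \in 'Z('chi_i)%CF.
    by move: zR; rewrite -(cap_cfcenter_irr G) => /bigcapP/(_ i isT).
  rewrite -irrRepr cfcenter_repr inE zG => /is_scalar_mxP[c].
  by exists c.
have d0 : (0 < d)%N by apply: irr_degree_gt0.
have c1 : c = -1.
  have : c ^+ 2 == 1.
    have : rG z *m rG z = 1%:M by rewrite -repr_mxM // -expg2 z2 repr_mx1.
    rewrite rz -scalar_mxM -expr2 => /matrixP/(_ (Ordinal d0) (Ordinal d0)).
    by rewrite !mxE eqxx !mulr1n => ->.
  rewrite sqrf_eq1 => /orP[/eqP c1|/eqP//].
  case/negP: zi; rewrite -irrRepr cfker_repr; apply/rkerP.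
  by rewrite -/rG rz c1.
have rzN g : g \in G -> rG (g * z)%g = - rG g.
  by move=> gG; rewrite repr_mxM // rz c1 mul_mx_scalar scaleN1r.
have chiE g : g \in G -> 'chi_i g = \tr (rG g).
  by move=> gG; rewrite -irrRepr cfunE gG mulr1n.
(* A noncentral g is conjugate to gz, on which the character takes the opposite value. *)
have chi0 g : g \in G -> g \notin Z -> 'chi_i g = 0.
  move=> gG; rewrite -eZ inE gG /= => gC.
  have [y yG gy] : exists2 y, y \in G & (g ^ y)%g = (g * z)%g.
    have : ~~ [forall y in G, g ^ y == g]%g.
      apply: contra gC => /forall_inP h; apply/centP => y yG.
      exact/commgP/conjg_fixP/eqP/h.
    rewrite negb_forall_in => /exists_inP[y yG gy]; exists y => //.
    by have := hz gG yG; rewrite !inE (negbTE gy) => /eqP.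
  have : 'chi_i g = - 'chi_i g.
    rewrite {1}chiE // -[in RHS](cfunJ 'chi_i g yG) gy [in RHS]chiE ?groupM //.
    by rewrite rzN // linearN opprK.
  by move/eqP; rewrite -addr_eq0 -mulr2n mulrn_eq0 /= => /eqP.
have chi1 : 'chi_i 1%g = d%:R := irr1_degree i.
(* The character vanishes off its center Z, so its degree squared is |G : Z| = s^2. *)
have ds : d = s.
  have cZ : 'Z('chi_i)%CF = Z.
    apply/eqP; rewrite eqEsubset; apply/andP; split; last first.
      apply/subsetP => x xZ; have : x \in 'Z(G) by rewrite eZ.
      by rewrite -(cap_cfcenter_irr G) => /bigcapP/(_ i isT).
    apply/subsetP => x xC; have xG := subsetP (cfcenter_sub _) x xC.
    move: xC; rewrite irr_cfcenterE //; apply: contraTT => xZ.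
    by rewrite chi0 // normr0 eq_sym irr1_neq0.
  have := irr1_bound i => -[_]; rewrite cZ.
  have -> : 'chi_i \in 'CF(G, Z).
    apply/cfun_onP => x xZ; case: (boolP (x \in G)) => xG; first exact: chi0.
    exact: cfun0.
  rewrite chi1 -divgS // (AS_cardG cfg) mulnK ?cardG_gt0 // -natrX eqr_nat.
  by rewrite -[(s * s)%N]/(s ^ 2)%N eqn_exp2r // => /eqP.
pose E := \bigcup_j A j; pose M := \sum_(e in E) rG e.
have EG : E \subset G by apply/bigcupsP.
have EZ g : g \in E -> g \in Z -> g = 1%g.
  case/bigcupP => j _ gA gZ; apply/set1P; rewrite -set1gE -(AS_TIZ cfg j).
  by rewrite inE gA.
have /card_gt0P[j0 _] : (0 < #|J|)%N by rewrite (AS_cardJ cfg).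
have E1 : 1%g \in E by apply/bigcupP; exists j0.
have trM : \tr M = s%:R.
  rewrite raddf_sum (bigD1 1%g) //= big1 ?addr0; first by rewrite repr_mx1 mxtrace1 -ds.
  move=> e /andP[eE e1]; have eG := subsetP EG e eE.
  by rewrite -chiE // chi0 //; apply: contra e1 => eZ'; rewrite (EZ e).
have sum0 (X : {set gT}) : X \subset G -> X :* z = X -> \sum_(g in X) rG g = 0.
  move=> sXG hX; set t := \sum_(g in X) _.
  have : t = - t.
    rewrite {1}/t -{1}hX (reindex_inj (mulIg z)) /= -sumrN.
    apply: eq_big => [g|g]; first by rewrite mem_rcoset mulgK.
    by rewrite mem_rcoset mulgK => /(subsetP sXG)/rzN.
  move/eqP; rewrite -addr_eq0 -mulr2n -scaler_nat scaler_eq0 pnatr_eq0 /=.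
  by move/eqP.
pose S j := \sum_(a in A j) rG a.
(* The coefficient of g is the number of elements of E in g A_j: s on A_j, 0 on the rest of A_j Z,
   and s / |Z| elsewhere. The last set is stable under z, so its sum vanishes by [sum0]. *)
have MS j : M *m S j = s%:R *: S j.
  have -> : M *m S j = \sum_(g in G) rG g *+ #|(g *: A j)%g :&: E|.
    rewrite mulmx_suml.
    transitivity (\sum_(e in E) \sum_(g in G | g \in (e *: A j)%g) rG g).
      apply: eq_bigr => e eE; have eG := subsetP EG e eE.
      rewrite mulmx_sumr [RHS](reindex_inj (mulgI e)) /=; apply: eq_big => [a|a aA].
        rewrite mem_lcoset mulKg groupMl //.
        by case: (boolP (a \in A j)) => [/(subsetP (AG j))->|]; rewrite ?andbF.
      by rewrite repr_mxM // (subsetP (AG j)).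
    rewrite (exchange_big_dep [in G]) /=; last by move=> e g _ /andP[].
    apply: eq_bigr => g gG; rewrite sumr_const; congr (_ *+ _).
    by apply: eq_card => e; rewrite in_setI lcoset_sym unfold_in /= gG andbC.
  have cX g : g \in (A j * Z)%g -> #|(g *: A j)%g :&: E| = ((g \in A j) * s)%N.
    move=> gAZ; case: (boolP (g \in A j)) => gA.
      have sAE : A j \subset E by apply: (bigcup_sup j).
      by rewrite mul1n lcoset_id // (setIidPl sAE) cA.
    apply/eqP; rewrite mul0n cards_eq0 -subset0; apply/subsetP => e.
    case/setIP=> /lcosetP[a aA ->] /bigcupP[k _ ek].
    case/negP: gA; have [ekj|kj] := eqVneq k j.
      by move: ek; rewrite ekj groupMr.
    have : (g * a)%g \in (A j * Z)%g.
      by rewrite (AS_mulZr cfg) // (subsetP (AS_sub_mulZ Z A j)).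
    move/(AS_TI1 cfg kj ek) => /(canRL (mulgK a)) ->.
    by rewrite mul1g groupV.
  rewrite (bigID [in (A j * Z)%g]) /= [X in _ + X](_ : _ = 0) ?addr0.
    rewrite scaler_sumr big_mkcond [RHS]big_mkcond /=; apply: eq_bigr => g _.
    case: (boolP (g \in A j)) => gA.
      have gAZ := subsetP (AS_sub_mulZ Z A j) g gA.
      by rewrite gAZ (subsetP (AG j)) // cX // gA mul1n scaler_nat.
    by case: ifP => // /andP[_ gAZ]; rewrite cX // (negbTE gA) mul0n.
  rewrite (eq_bigr (fun g => rG g *+ (s %/ #|Z|))); last first.
    move=> g /andP[gG gA]; congr (_ *+ _).
    by rewrite -[in RHS](AS_adj cfg gG gA) mulnK ?cardG_gt0.
  rewrite sumrMnl (eq_bigl [in G :\: (A j * Z)%g]) => [|g]; last by rewrite inE andbC.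
  rewrite sum0 ?mul0rn ?subsetDl //.
  apply/eqP; rewrite eqEcard card_rcoset leqnn andbT.
  apply/subsetP => _ /rcosetP[g /setDP[gG gA] ->].
  by rewrite inE groupM // andbT (AS_mulZr cfg) // (subsetP (AS_Zsub_mulZ Z A j)).
have SE : \sum_j S j = M + s%:R%:M.
  transitivity (\sum_(e in E) rG e *+ #|[set j | e \in A j]|).
    rewrite (exchange_big_dep [in E]) /=.
      by apply: eq_bigr => e _; rewrite -sumr_const; apply: eq_bigl => j; rewrite inE.
    by move=> j e _ eA; apply/bigcupP; exists j.
  rewrite /M !(bigD1 1%g E1) /= repr_mx1.
  have -> : [set j | 1%g \in A j] = [set: J] by apply/setP => j; rewrite !inE group1.
  rewrite cardsT (AS_cardJ cfg) mulrS -!addrA; congr (_ + _).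
  rewrite addrC; congr (_ + _); last by rewrite -scaler_nat scalemx1.
  apply: eq_bigr => e /andP[/bigcupP[k _ ek] e1].
  have -> : [set j | e \in A j] = [set k].
    apply/setP => j; rewrite !inE; apply/idP/eqP => [ej|->//].
    apply: contraNeq e1 => jk; apply/eqP/(AS_TI1 cfg jk ej).
    exact: (subsetP (AS_sub_mulZ Z A k)).
  by rewrite cards1.
(* Summing [MS] over j gives M(M + s) = s(M + s). *)
have M2 : M *m M = (s ^ 2)%:R%:M.
  have : M *m (M + s%:R%:M) = s%:R *: (M + s%:R%:M).
    by rewrite -SE mulmx_sumr scaler_sumr; apply: eq_bigr => j _; apply: MS.
  rewrite mulmxDr mul_mx_scalar scalerDr addrC => /addrI ->.
  by rewrite scale_scalar_mx -natrM.
have s0 : s%:R != 0 :> algC by rewrite pnatr_eq0 -lt0n (AS_pos cfg).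
pose P := 2^-1 *: (1%:M + s%:R^-1 *: M).
have idP : P *m P = P.
  set x := s%:R^-1 *: M in P *.
  have xx : x *m x = 1%:M.
    rewrite -scalemxAl -scalemxAr M2 !scale_scalar_mx natrX expr2.
    by rewrite (mulKf s0) mulVf.
  rewrite /P -scalemxAl -scalemxAr scalerA mulmxDl mul1mx mulmxDr mulmx1 xx.
  rewrite [x + _]addrC -mulr2n -scaler_nat scalerA -mulrA mulVf ?mulr1 //.
  by rewrite pnatr_eq0.
have := mxtrace_idem idP; rewrite /P mxtraceZ mxtraceD mxtrace1 mxtraceZ trM.
rewrite mulVf //; move: (\rank _) => r; rewrite -/d ds.
have n2 : 2%:R != 0 :> algC by rewrite pnatr_eq0.
(* The rank r of P satisfies s + 1 = 2r, against s even. *)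
move/(canRL (mulVKf n2)); rewrite natr1 -natrM => /eqP.
rewrite eqr_nat => /eqP e; have := AS_even cfg.
by have := odd_double r; rewrite -mul2n -e /= => /negbFE ->.
Qed.

Lemma AS_central : exp2 G.
Proof.
case: (boolP [forall v in Z, v ^+ 2 == 1]%g) => [/forall_inP h|].
  by apply: AS_central_exp2Z => v vZ; apply/eqP/h.
rewrite negb_forall_in => /exists_inP[v vZ v2]; exfalso.
by apply: AS_central_contra => h; case/eqP: v2; apply: h.
Qed.

End Central.

(** * Quotients and induction *)

Section Quotient.
Variables (gT : finGroupType) (J : finType) (s : nat).
Variables (G Z : {group gT}) (A : J -> {group gT}) (z : gT).
Hypothesis cfg : AS_config s G Z A.
Hypotheses (zZ : z \in Z) (zR : z \in 'Z(G)) (oz : #[z] = 2).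

Let AG := AS_sub cfg.
Let cA := AS_card cfg.
Let ZG : Z \subset G := normal_sub (AS_normal cfg).
Local Notation K := <[z]>.

Lemma cycle2_mem x : (x \in K) = (x \in [set 1; z]).
Proof. by rewrite cycle2g. Qed.

Lemma AS_K_normal : K <| G.
Proof. by apply: sub_center_normal; rewrite cycle_subG. Qed.

Let nK : G \subset 'N(K) := normal_norm AS_K_normal.
Let sKZ : K \subset Z. Proof. by rewrite cycle_subG. Qed.

Lemma AS_coset_eq x y :
  x \in G -> y \in G -> coset K x = coset K y -> x = y \/ x = y * z.
Proof.
move=> xG yG /(rcoset_kercosetP (subsetP nK x xG) (subsetP nK y yG)).
case/rcosetP => k; rewrite /= cycle2_mem => /set2P[] -> ->; first by left; rewrite mul1g.
by right; case/centerP: zR => _; apply.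
Qed.

Lemma AS_coset_mem (B : {group gT}) x :
  K \subset B -> B \subset G -> x \in G -> coset K x \in B / K -> x \in B.
Proof.
move=> sKB sBG xG xB.
rewrite -(quotientGK (normalS sKB sBG AS_K_normal)).
by rewrite mem_morphpre ?(subsetP nK).
Qed.

Lemma AS_quotient_AZ j : (A j / K) * (Z / K) = (A j <*> Z) / K.
Proof.
rewrite (AS_joinE cfg) quotientMl //; exact: subset_trans (AG j) nK.
Qed.

Lemma AS_double_quotient (B : {group gT}) :
  K \subset B -> B \subset G -> #|B| = (2 * #|B / K|)%N.
Proof.
move=> sKB sBG; rewrite card_quotient ?(subset_trans sBG) //.
by rewrite -oz; apply/esym/Lagrange.
Qed.

Lemma AS_quotient_config :
  AS_config s (G / K)%G (Z / K)%G (fun j => A j / K)%G.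
Proof.
have TIK j : K :&: A j = 1.
  apply/eqP; rewrite -subG1 -(AS_TIZ cfg j) subsetI subsetIr.
  exact: subset_trans (subsetIl _ _) sKZ.
have zA j : z \notin A j.
  apply/negP => zA; have : z \in A j :&: Z by rewrite inE zA.
  by rewrite (AS_TIZ cfg) inE => /eqP z1; have := oz; rewrite z1 order1.
have memAZ j x : x \in G -> coset K x \in (A j / K) * (Z / K) -> x \in A j * Z.
  move=> xG; rewrite AS_quotient_AZ -(AS_joinE cfg) => /AS_coset_mem; apply=> //.
    exact: subset_trans sKZ (joing_subr _ _).
  by rewrite join_subG AG.
have cZ := AS_double_quotient sKZ ZG.
have cG := AS_double_quotient (normal_sub AS_K_normal) (subxx G).
(* The coset in the quotient lifts to g A_j and gz A_j, each with s / |Z| elements of E. These stay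
   distinct modulo K since z lies in no A_l; the count doubles while |Z| is halved. *)
have adjK j g : g \in G / K -> g \notin (A j / K) * (Z / K) ->
    (#|g *: (A j / K) :&: \bigcup_i (A i / K)| * #|Z / K| = s)%N.
  case/morphimP=> {g}g gN gG -> gAZ.
  have {}gAZ : g \notin A j * Z.
    by apply: contra gAZ; rewrite AS_quotient_AZ -(AS_joinE cfg); apply: mem_quotient.
  have zG := subsetP ZG z zZ.
  have gzAZ : g * z \notin A j * Z.
    by rewrite (AS_mulZr cfg) // (subsetP (AS_Zsub_mulZ Z A j)).
  have := AS_adj cfg gG gAZ; have := AS_adj cfg (groupM gG zG) gzAZ.
  set E := \bigcup_i A i.
  have EG : E \subset G by apply/bigcupsP.
  pose X := (g *: A j :&: E) :|: ((g * z) *: A j :&: E).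
  suff -> : coset K g *: (A j / K) :&: \bigcup_i (A i / K) = coset K @: X.
    rewrite card_in_imset /X.
      rewrite cardsU setIACA setIid (_ : _ :&: _ :&: E = set0) ?cards0 ?subn0.
        rewrite cZ mulnCA => e2; rewrite mulnCA => e1.
        apply/eqP; rewrite -(eqn_pmul2l (isT : 0 < 2)%N) mulnDl mulnDr e1 e2.
        by rewrite mul2n addnn.
      apply/eqP; rewrite -subset0; apply/subsetP => _ /setIP[/setIP[/lcosetP[a aA ->]]].
      case/lcosetP => b bA; rewrite -mulgA => /mulgI e _.
      by case/negP: (zA j); rewrite -(groupMr z bA) -e.
    move=> x y xX yX.
    have XE : X \subset E by rewrite subUset !subsetIr.
    have {xX} xE := subsetP XE x xX; have {yX} yE := subsetP XE y yX.
    case/(AS_coset_eq (subsetP EG x xE) (subsetP EG y yE)) => // e.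
    case/bigcupP: xE => k _ xk; case/bigcupP: yE => l _ yl.
    case/negP: (zA l); rewrite -(groupMl z yl) -e.
    have [<-//|kl] := eqVneq k l; rewrite (AS_TI1 cfg kl xk) ?group1 //.
    rewrite e (AS_mulZr cfg) ?(subsetP (AS_sub_mulZ Z A l) y yl) //.
    exact: (subsetP (AS_Zsub_mulZ Z A l)).
  apply/setP => u; apply/idP/imsetP.
    case/setIP => /lcosetP[_ /morphimP[a aN aA ->] ->] /bigcupP[k _ /morphimP[e eN ek]].
    have aG := subsetP (AG j) a aA; have eG := subsetP (AG k) e ek.
    rewrite -coset_morphM // => h.
    have eE : e \in E by apply/bigcupP; exists k.
    exists e; last exact: h.
    rewrite !inE eE !andbT; apply/orP.
    have [->|->] := AS_coset_eq eG (groupM gG aG) (esym h).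
      by left; rewrite mem_lcoset mulKg.
    have /centerP[_ zC] := zR.
    by right; rewrite -mulgA -(zC a aG) mulgA mem_lcoset mulKg.
  have gE e (h : gT) : coset K h = coset K g -> h \in G -> e \in h *: A j :&: E ->
      coset K e \in coset K g *: (A j / K) :&: \bigcup_i (A i / K).
    move=> eg hG /setIP[/lcosetP[a aA ->] /bigcupP[k _ hk]].
    have aG := subsetP (AG j) a aA; apply/setIP; split; last first.
      by apply/bigcupP; exists k => //; apply: mem_quotient.
    have hN := subsetP nK h hG; have aN := subsetP nK a aG.
    rewrite coset_morphM // eg; apply/lcosetP; exists (coset K a) => //.
    exact: mem_quotient.
  move=> [e /setUP[] eX ->]; first exact: (gE e g).
  by apply: (gE e (g * z)) => //; [rewrite coset_kerr ?cycle_id | apply: groupM].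
split; first split=> /=.
- exact: AS_cardJ cfg.
- exact: AS_even cfg.
- exact: AS_pos cfg.
- exact: quotient_normal (AS_normal cfg).
- exact: leq_trans (leq_quotient _ _) (AS_leZ cfg).
- by move=> j; apply: quotientS.
- move=> j; rewrite -(cA j); apply/esym/card_isog/quotient_isog => //.
  exact: subset_trans (AG j) nK.
- apply/eqP; rewrite -(eqn_pmul2l (isT : 0 < 2)%N) -cG (AS_cardG cfg) cZ.
  by rewrite mulnCA.
- move=> i j ij; apply/subsetP => _ /setIP[/morphimP[a aN aA ->] aAZ].
  have aG := subsetP (AG i) a aA.
  by rewrite (AS_TI1 cfg ij aA (memAZ j a aG aAZ)) morph1 inE.
- by move=> j g gG gAZ; apply: adjK.
- exact: quotient_pgroup (AS_2group cfg).
- move=> j _ /morphimP[a aN aA ->].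
  by rewrite -morphX // (AS_exp2 cfg aA) morph1.
Qed.

End Quotient.

Theorem AS_config_exp2 (J : finType) (s : nat) (gT : finGroupType)
    (G Z : {group gT}) (A : J -> {group gT}) :
  AS_config s G Z A -> exp2 G.
Proof.
have [n] := ubnP #|Z|; elim: n gT G Z A => // n IH gT G Z A ltZ cfg.
have [Z1|nZ1] := eqVneq (Z : {set gT}) 1.
  move=> g /(AS_cover cfg)[j]; rewrite Z1 mulg1; exact: (AS_exp2 cfg).
have ZG := normal_sub (AS_normal cfg).
have := meet_center_nil (pgroup_nil (AS_2group cfg)) (AS_normal cfg) nZ1.
have p2 : 2.-group (Z :&: 'Z(G)).
  by apply: pgroupS (AS_2group cfg); apply: subset_trans (subsetIr _ _) (center_sub _).
move=> /(pgroup_pdiv p2)[_ /(Cauchy (isT : prime 2))[z /setIP[zZ zR] oz] _].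
have qcfg := AS_quotient_config cfg zZ zR oz.
have z1 : z != 1 by apply/eqP => z1; have := oz; rewrite z1 order1.
have z2 : z ^+ 2 = 1 by rewrite -oz expg_order.
have sKZ : <[z]> \subset Z by rewrite cycle_subG.
(* By induction the quotient has exponent 2, so the commutators of G lie in <z>. *)
have abGK : abelian (G / <[z]>).
  apply: exp2_abelian; apply: (IH _ (G / <[z]>)%G (Z / <[z]>)%G) qcfg.
  apply: leq_trans (ltZ : #|Z| <= n)%N.
  by rewrite (AS_double_quotient zR oz sKZ ZG) ltn_Pmull ?cardG_gt0.
have hz : {in G &, forall x y, x ^ y \in [set x; x * z]}.
  move=> x y xG yG.
  have nK := normal_norm (AS_K_normal zR).
  have e : coset <[z]> (x ^ y) = coset <[z]> x.
    rewrite morphJ ?(subsetP nK) // conjgE (centsP abGK (coset _ x)) ?mulKg //;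
      exact: mem_quotient.
  by have [->|->] := AS_coset_eq zR oz (groupJ xG yG) xG e; rewrite !inE eqxx ?orbT.
case: (boolP (Z \subset 'Z(G))) => ZR.
  exact: (AS_central cfg zZ zR z1 z2 hz ZR).
by case: (AS_noncentral cfg zZ zR z1 hz ZR).
Qed.

(** * The configuration of a skew translation quadrangle *)

Section PairActions.
Variables Pt Ln : finType.
Local Notation aut_t := ({perm Pt} * {perm Ln})%type.

(** Both components are packaged as actions so that stabilizers in G are groups. *)
Definition pt_act (x : Pt) (g : aut_t) : Pt := g.1 x.
Definition ln_act (l : Ln) (g : aut_t) : Ln := g.2 l.

Lemma pt_act1 x : pt_act x 1 = x. Proof. exact: perm1. Qed.
Lemma pt_actM x : act_morph pt_act x.
Proof. by move=> g h; apply: permM. Qed.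
Lemma ln_act1 l : ln_act l 1 = l. Proof. exact: perm1. Qed.
Lemma ln_actM l : act_morph ln_act l.
Proof. by move=> g h; apply: permM. Qed.

Canonical pt_action := TotalAction pt_act1 pt_actM.
Canonical ln_action := TotalAction ln_act1 ln_actM.

End PairActions.

(** * Points and lines of a generalized quadrangle of order s *)

Section Geometry.
Variables (Pt Ln : finType) (I : Pt -> Ln -> bool) (s : nat).
Hypothesis gq : is_GQ I s s.
Local Notation coll := (collinear I).

Lemma GQ_s_gt0 : (0 < s)%N. Proof. by case: gq => -[]. Qed.

Lemma collP x y : reflect (exists2 l, I x l & I y l) (coll x y).
Proof.
by apply: (iffP existsP) => [[l /andP[]]|[l xl yl]]; exists l; rewrite // xl.
Qed.

Lemma coll_sym x y : coll x y = coll y x.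
Proof. by apply/collP/collP => -[l]; exists l. Qed.

Lemma coll_line x y l : I x l -> I y l -> coll x y.
Proof. by move=> xl yl; apply/collP; exists l. Qed.

Lemma GQ_line x y l m : x != y -> I x l -> I y l -> I x m -> I y m -> l = m.
Proof. by case: gq => _ _ _ h _; apply: h. Qed.

Lemma GQ_proj_uniq x l y y' :
  ~~ I x l -> I y l -> coll x y -> I y' l -> coll x y' -> y = y'.
Proof.
case: gq => _ _ _ _ h /h /eqP/cards1P[w ew] yl xy yl' xy'.
have : y \in [set w] by rewrite -ew inE yl.
have : y' \in [set w] by rewrite -ew inE yl'.
by rewrite !inE => /eqP -> /eqP ->.
Qed.

Lemma GQ_proj x l : ~~ I x l -> exists2 y, I y l & coll x y.
Proof.
case: gq => _ _ _ _ h /h /eqP/cards1P[w ew].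
by have := set11 w; rewrite -ew inE => /andP[]; exists w.
Qed.

Lemma GQ_other_point x l : exists2 y, I y l & y != x.
Proof.
case: gq => -[s0 _] h _ _ _; have := h l => c.
have : (1 < #|[set y | I y l]|)%N by rewrite c ltnS.
case/card_gt1P => y [y' []]; rewrite !inE => yl yl' yy'.
have [yx|] := eqVneq y x; last by exists y.
by exists y' => //; rewrite -yx eq_sym.
Qed.

Lemma GQ_other_line x l : exists2 m, I x m & m != l.
Proof.
case: gq => -[s0 _] _ h _ _; have := h x => c.
have : (1 < #|[set m | I x m]|)%N by rewrite c ltnS.
case/card_gt1P => m [m' []]; rewrite !inE => xm xm' mm'.
have [ml|] := eqVneq m l; last by exists m.
by exists m' => //; rewrite -ml eq_sym.
Qed.

Lemma coll_refl x : coll x x.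
Proof.
case: gq => _ _ h _ _; have /card_gt0P[l] : (0 < #|[set l | I x l]|)%N by rewrite h.
by rewrite inE => xl; apply: (coll_line xl).
Qed.

(** Leave p along a line l to z, then z along a second line to y; if y were collinear with p, it
    would have two projections on l. *)
Lemma GQ_noncoll p : exists y, ~~ coll p y.
Proof.
case: gq => _ _ h _ _; have /card_gt0P[l] : (0 < #|[set l | I p l]|)%N by rewrite h.
rewrite inE => pl; have [z zl zp] := GQ_other_point p l.
have [m zm ml] := GQ_other_line z l; have [y ym yz] := GQ_other_point z m.
exists y; apply/negP; rewrite coll_sym => yp.
have yl : ~~ I y l.
  by apply: contra ml => yl; apply/eqP; apply: (GQ_line yz).
by case/eqP: zp; apply: (GQ_proj_uniq yl zl _ pl yp); apply: coll_line ym zm.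
Qed.

(** * The elation group and its stabilizers *)

Section Elation.
Variables (p : Pt) (G : {group ({perm Pt} * {perm Ln})%type}).
Hypothesis egq : is_EGQ I p G.

Lemma EGQ_aut g x l : g \in G -> I (g.1 x) (g.2 l) = I x l.
Proof. by case: egq => h _ /h[-> ]. Qed.

Lemma EGQ_line_fix g l : g \in G -> I p l -> g.2 l = l.
Proof.
by case: egq => h _ /h[_ [->|[f _]]]; [rewrite perm1 | apply: f].
Qed.

Lemma EGQ_p_fix g : g \in G -> g.1 p = p.
Proof.
move=> gG; have /collP[l pl _] := coll_refl p.
have [m pm ml] := GQ_other_line p l; apply/eqP; apply: contraR ml => gp.
have gl k : I p k -> I (g.1 p) k by move=> pk; rewrite -(EGQ_line_fix gG pk) EGQ_aut.
by apply/eqP/(GQ_line gp); rewrite ?gl.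
Qed.

Lemma EGQ_coll g x y : g \in G -> coll (g.1 x) (g.1 y) = coll x y.
Proof.
move=> gG; apply/collP/collP => -[l].
  by rewrite -(permKV g.2 l) !EGQ_aut //; exists (g.2^-1 l)%g.
by move=> xl yl; exists (g.2 l); rewrite EGQ_aut.
Qed.

Lemma EGQ_noncoll g x : g \in G -> ~~ coll p (g.1 x) = ~~ coll p x.
Proof. by move=> gG; rewrite -{1}(EGQ_p_fix gG) EGQ_coll. Qed.

Lemma EGQ_inj y g h :
  ~~ coll p y -> g \in G -> h \in G -> g.1 y = h.1 y -> g = h.
Proof.
move=> py gG hG e; case: egq => _ /(_ y (h.1 y) py).
rewrite EGQ_noncoll // => /(_ py) /eqP/cards1P[k ek].
have : g \in [set k] by rewrite -ek inE gG e eqxx.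
have : h \in [set k] by rewrite -ek inE hG eqxx.
by rewrite !inE => /eqP -> /eqP ->.
Qed.

Lemma EGQ_trans x y :
  ~~ coll p x -> ~~ coll p y -> exists2 g, g \in G & g.1 x = y.
Proof.
move=> px py; case: egq => _ /(_ x y px py) /eqP/cards1P[k ek].
by have := set11 k; rewrite -ek inE => /andP[kG /eqP]; exists k.
Qed.

Variable y0 : Pt.
Hypothesis py0 : ~~ coll p y0.

Definition pencil := {l : Ln | I p l}.
Implicit Types (l k : pencil).

(** The projection of [y0] onto l; [footP] shows that the default never occurs. *)
Definition foot l : Pt := odflt p [pick x | I x (val l) && coll y0 x].
Definition join l : Ln := odflt (val l) [pick m | I y0 m && I (foot l) m].

Lemma y0_notin l : ~~ I y0 (val l).
Proof. by apply: contra py0; apply: coll_line (valP l). Qed.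

Lemma noncoll_notin y l : ~~ coll p y -> ~~ I y (val l).
Proof. by apply: contra; apply: coll_line (valP l). Qed.

Lemma footP l : I (foot l) (val l) /\ coll y0 (foot l).
Proof.
rewrite /foot; case: pickP => [x /andP[]|none] //=.
have [x xl yx] := GQ_proj (y0_notin l).
by have := none x; rewrite xl yx.
Qed.

Lemma joinP l : I y0 (join l) /\ I (foot l) (join l).
Proof.
rewrite /join; case: pickP => [x /andP[]|none] //=.
have [_ /collP[m ym fm]] := footP l.
by have := none m; rewrite ym fm.
Qed.

Lemma foot_uniq x l : I x (val l) -> coll y0 x -> x = foot l.
Proof.
by have [fl yf] := footP l => xl yx; apply: GQ_proj_uniq (y0_notin l) _ _ _ _.
Qed.

Lemma foot_coll l : coll p (foot l).
Proof. by have [fl _] := footP l; apply: coll_line (valP l) fl. Qed.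

Lemma foot_neq_p l : foot l != p.
Proof.
by apply: contra py0 => /eqP e; rewrite coll_sym -e; case: (footP l).
Qed.

Lemma p_notin_join l : ~~ I p (join l).
Proof. by have [ym _] := joinP l; apply: contra py0 => pm; apply: coll_line pm ym. Qed.

Lemma join_coll_p x l : I x (join l) -> coll p x -> x = foot l.
Proof.
have [_ fm] := joinP l => xm px.
exact: GQ_proj_uniq (p_notin_join l) xm px fm (foot_coll l).
Qed.

Lemma foot_inj : injective foot.
Proof.
move=> l k e; apply: val_inj; have [fl _] := footP l; have [fk _] := footP k.
rewrite -e in fk.
by apply: (GQ_line (foot_neq_p l)) => //; apply: valP.
Qed.

Lemma foot_notin_join l k : l != k -> ~~ I (foot k) (join l).
Proof.
move=> lk; apply: contra lk => fk; apply/eqP/esym/foot_inj.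
exact: join_coll_p fk (foot_coll k).
Qed.

Lemma join_ex m : I y0 m -> exists l, m = join l.
Proof.
move=> ym; have pm : ~~ I p m by apply: contra py0 => pm; apply: coll_line pm ym.
have [q qm /collP[k pk qk]] := GQ_proj pm.
pose l : pencil := exist _ k pk; exists l.
have e : q = foot l by apply: foot_uniq => //; apply: coll_line ym qm.
have [yj fj] := joinP l; have [_ _] := footP l.
apply: (GQ_line _ ym qm yj); last by rewrite e.
by apply: contra (y0_notin l) => /eqP ->.
Qed.

Local Notation pt_action := (pt_action Pt Ln).
Local Notation ln_action := (ln_action Pt Ln).

(** These three groups play the roles of A_l, A_l Z and Z. *)
Definition line_stab l := 'C_G[join l | ln_action]%G.
Definition foot_stab l := 'C_G[foot l | pt_action]%G.
Definition perp_stab := 'C_G([set x | coll p x] | pt_action)%G.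

Lemma line_stabP g l :
  reflect (g \in G /\ g.2 (join l) = join l) (g \in line_stab l).
Proof.
apply: (iffP setIP) => -[gG h]; split=> //; first exact: (astab1P h).
exact/astab1P.
Qed.

Lemma foot_stabP g l :
  reflect (g \in G /\ g.1 (foot l) = foot l) (g \in foot_stab l).
Proof.
apply: (iffP setIP) => -[gG h]; split=> //; first exact: (astab1P h).
exact/astab1P.
Qed.

Lemma perp_stabP g :
  reflect (g \in G /\ forall x, coll p x -> g.1 x = x) (g \in perp_stab).
Proof.
apply: (iffP setIP) => -[gG h]; split=> //.
  by move=> x px; apply: (astabP h); rewrite inE.
by apply/astabP => x; rewrite inE; apply: h.
Qed.

(** g fixes l, so both [foot l] and its image are the projection of g(y0) onto l; [join l] and its
    image then share two points. *)
Lemma line_stab_of_point g l :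
  g \in G -> I (g.1 y0) (join l) -> g \in line_stab l /\ g.1 (foot l) = foot l.
Proof.
move=> gG gm; have [ym fm] := joinP l; have [fl _] := footP l.
have py : ~~ coll p (g.1 y0) by rewrite EGQ_noncoll.
have yl := noncoll_notin l py.
have gf : g.1 (foot l) = foot l.
  apply: (GQ_proj_uniq yl) => //.
  - by rewrite -{1}(EGQ_line_fix gG (valP l)) EGQ_aut.
  - by apply: (coll_line (l := g.2 (join l))); rewrite EGQ_aut.
  - exact: coll_line gm fm.
split=> //; apply/line_stabP; split=> //.
apply: (@GQ_line (g.1 y0) (foot l)) => //.
- by apply: contra yl => /eqP ->.
- by rewrite EGQ_aut.
- by rewrite -{1}gf EGQ_aut.
Qed.

Lemma line_stab_point g l : g \in line_stab l -> I (g.1 y0) (join l).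
Proof.
by case/line_stabP => gG e; rewrite -e EGQ_aut //; case: (joinP l).
Qed.

Lemma line_stab_sub_foot l : line_stab l \subset foot_stab l.
Proof.
apply/subsetP => g gA; have /line_stabP[gG _] := gA.
by have [_ e] := line_stab_of_point gG (line_stab_point gA); apply/foot_stabP.
Qed.

Lemma perp_stab_sub_foot l : perp_stab \subset foot_stab l.
Proof.
by apply/subsetP => g /perp_stabP[gG h]; apply/foot_stabP; rewrite h ?foot_coll.
Qed.

(** The group acts regularly on the points of [join l] other than [foot l]. *)
Lemma card_line_stab l : #|line_stab l| = s.
Proof.
have -> : #|line_stab l| = #|[set pt_act y0 g | g in line_stab l]|.
  rewrite card_in_imset // => g h /line_stabP[gG _] /line_stabP[hG _].
  exact: EGQ_inj.
have [ym fm] := joinP l.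
have -> : [set pt_act y0 g | g in line_stab l] = [set x | I x (join l)] :\ foot l.
  apply/setP => x; rewrite !inE; apply/imsetP/andP => [[g gA ->]|[xf xm]].
    rewrite line_stab_point //; split=> //; have /line_stabP[gG _] := gA.
    have : ~~ coll p (g.1 y0) by rewrite EGQ_noncoll.
    by apply: contra => /eqP; rewrite /pt_act => ->; apply: foot_coll.
  have px : ~~ coll p x by apply: contra xf => /(join_coll_p xm) ->.
  have [g gG gx] := EGQ_trans py0 px; exists g; last by rewrite -gx.
  have gm : I (g.1 y0) (join l) by rewrite gx.
  by have [] := line_stab_of_point gG gm.
case: gq => _ h _ _ _; have := h (join l).
by rewrite (cardsD1 (foot l)) inE fm add1n => -[].
Qed.

Lemma card_pencil : #|{: pencil}| = s.+1.
Proof. by case: gq => _ _ h _ _; rewrite card_sig -(h p); apply: eq_card => x; rewrite inE. Qed.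

(* foot_stab l permutes the s lines on foot l other than l, and line_stab l is
   the stabilizer of one of them. *)
Lemma card_foot_stab l : (#|foot_stab l| <= s * s)%N.
Proof.
rewrite -(card_orbit_stab ln_action (foot_stab l) (join l)).
have [fl _] := footP l; have [ym fm] := joinP l; apply: leq_mul.
  case: gq => _ _ h _ _; have := h (foot l).
  rewrite (cardsD1 (val l)) inE fl add1n => -[<-].
  apply: subset_leq_card; apply/subsetP => _ /orbitP[g /foot_stabP[gG gf] <-].
  rewrite !inE /= /ln_act -gf EGQ_aut // fm andbT -{1}(EGQ_line_fix gG (valP l)).
  rewrite (inj_eq perm_inj); apply: contra (y0_notin l) => /eqP <-.
  by case: (joinP l).
rewrite -(card_line_stab l); apply: subset_leq_card; apply/subsetP => g.
by case/setIP => /foot_stabP[gG _] /astab1P gm; apply/line_stabP.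
Qed.

(** y0 and g(y0) are both the projection of [foot j] onto [join i]. *)
Lemma foot_line_meet g i j :
  i != j -> g \in line_stab i -> g \in foot_stab j -> g = 1.
Proof.
move=> ij gA /foot_stabP[gG gf]; apply: (EGQ_inj py0) => //.
rewrite perm1; have [fj yf] := footP j; have [ym _] := joinP i.
apply: (GQ_proj_uniq (foot_notin_join ij)) => //.
- exact: line_stab_point.
- by rewrite -gf EGQ_coll // coll_sym.
- by rewrite coll_sym.
Qed.

Lemma line_stab_of_coll g :
  g \in G -> coll y0 (g.1 y0) -> exists l, g \in line_stab l.
Proof.
move=> gG /collP[m ym gm]; have [l el] := join_ex ym; exists l.
by rewrite el in gm; have [] := line_stab_of_point gG gm.
Qed.

Lemma line_stab_coll g l : g \in line_stab l -> coll y0 (g.1 y0).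
Proof.
by move=> gA; have [ym _] := joinP l; apply: coll_line ym (line_stab_point gA).
Qed.

Lemma perp_stab_normal : perp_stab <| G.
Proof.
apply/andP; split; first exact: subsetIl.
apply: normsI; first exact: normG.
apply: subset_trans (astab_norm _ _); apply/subsetP => g gG.
apply/astabsP => x; rewrite !inE /= /pt_act.
by rewrite -{1}(EGQ_p_fix gG) EGQ_coll.
Qed.

Hypothesis s_even : ~~ odd s.
Hypothesis perp_ge : (s <= #|perp_stab|)%N.

Lemma pencil_other l : exists k, k != l.
Proof.
have : (0 < #|[set~ l]|)%N by rewrite cardsC1 card_pencil GQ_s_gt0.
by case/card_gt0P => k; rewrite !inE; exists k.
Qed.

Lemma line_stab_mul_perp_TI l : line_stab l :&: perp_stab = 1.
Proof.
have [k kl] := pencil_other l; apply/trivgP/subsetP => g /setIP[gA gZ].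
rewrite eq_sym in kl.
by rewrite inE (foot_line_meet kl gA) // (subsetP (perp_stab_sub_foot k)).
Qed.

(** The factors meet trivially, so the product has at least s^2 elements, the upper bound for
    [foot_stab l]. *)
Lemma foot_stabE l : line_stab l * perp_stab = foot_stab l.
Proof.
apply/eqP; rewrite eqEcard mul_subG ?line_stab_sub_foot ?perp_stab_sub_foot //=.
rewrite TI_cardMg ?line_stab_mul_perp_TI // card_line_stab.
by apply: leq_trans (card_foot_stab l) _; rewrite leq_mul2l perp_ge orbT.
Qed.

Lemma card_perp_stab : #|perp_stab| = s.
Proof.
have /card_gt0P[l _] : (0 < #|{: pencil}|)%N by rewrite card_pencil.
apply/eqP; rewrite eqn_leq perp_ge andbT -(leq_pmul2l GQ_s_gt0).
rewrite -{1}(card_line_stab l) -TI_cardMg ?line_stab_mul_perp_TI //.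
by rewrite foot_stabE card_foot_stab.
Qed.

(** For b in A_l, g b^-1 lies in E exactly when b(y0) is collinear with g(y0). The quadrangle axiom
    gives one such point on [join l], and it is not [foot l] because g moves [foot l]. *)
Lemma line_stab_coset_card l g :
  g \in G -> g \notin foot_stab l ->
  #|(g *: line_stab l) :&: \bigcup_k line_stab k| = 1%N.
Proof.
move=> gG gB; have [fl yf] := footP l; have [ym fm] := joinP l.
have gy : ~~ coll p (g.1 y0) by rewrite EGQ_noncoll.
have gm : ~~ I (g.1 y0) (join l).
  apply: contra gB => /(line_stab_of_point gG)[gA _].
  exact: (subsetP (line_stab_sub_foot l)).
have [w wm gw] := GQ_proj gm.
have wf : w != foot l.
  apply: contra gB => /eqP e; apply/foot_stabP; split=> //.
  apply: (GQ_proj_uniq (noncoll_notin l gy)) => //.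
  - by rewrite -(EGQ_line_fix gG (valP l)) EGQ_aut.
  - by rewrite EGQ_coll.
  - by rewrite -e.
have pw : ~~ coll p w by apply: contra wf => /(join_coll_p wm) ->.
have [a aG ay] := EGQ_trans py0 pw.
have aA : a \in line_stab l.
  have am : I (a.1 y0) (join l) by rewrite ay.
  by have [] := line_stab_of_point aG am.
have mem b : b \in line_stab l ->
    (g * b^-1 \in \bigcup_k line_stab k) = coll (g.1 y0) (b.1 y0).
  move=> bA; have /line_stabP[bG _] := bA.
  have gbG : g * b^-1 \in G by rewrite groupM ?groupV.
  have e : coll (g.1 y0) (b.1 y0) = coll y0 ((g * b^-1).1 y0).
    rewrite -[g in LHS](mulgKV b) /= permM EGQ_coll //.
    by rewrite coll_sym.
  rewrite e; apply/bigcupP/idP => [[k _]|]; first exact: line_stab_coll.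
  by case/(line_stab_of_coll gbG) => k; exists k.
apply/eqP/cards1P; exists (g * a^-1); apply/setP => h; rewrite in_setI inE.
apply/andP/eqP => [[/lcosetP[b bA ->]]|->].
  have /line_stabP[bG _] := bA; rewrite -[b]invgK mem ?groupV // => gb.
  congr (g * _); rewrite !invgK; apply: (canRL invgK).
  apply: (EGQ_inj py0); rewrite ?groupV //; rewrite ay.
  apply: (GQ_proj_uniq gm) => //; apply: line_stab_point.
  by rewrite groupV.
by rewrite mem // ay mem_lcoset mulKg groupV.
Qed.

Lemma STGQ_family : AS_family s G perp_stab line_stab.
Proof.
have TI i j : i != j -> line_stab i :&: (line_stab j * perp_stab) \subset [1].
  move=> ij; apply/subsetP => g /setIP[gA]; rewrite foot_stabE => gB.
  by rewrite inE (foot_line_meet ij gA gB).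
have adj j g : g \in G -> g \notin line_stab j * perp_stab ->
    (#|(g *: line_stab j) :&: \bigcup_i line_stab i| * #|perp_stab| = s)%N.
  by rewrite foot_stabE card_perp_stab => gG gB; rewrite line_stab_coset_card ?mul1n.
split=> //.
- exact: card_pencil.
- exact: GQ_s_gt0.
- exact: perp_stab_normal.
- by rewrite card_perp_stab.
- by move=> j; apply: subsetIl.
- exact: card_line_stab.
(* For |G| = s^3, count G minus A_j Z by cosets of A_j: its order is s times the s(s - 1) elements
   of E outside A_j Z. *)
have /card_gt0P[j _] : (0 < #|{: pencil}|)%N by rewrite card_pencil.
pose X := G :\: (line_stab j * perp_stab).
pose E := \bigcup_i line_stab i.
have sAG k : line_stab k \subset G by apply: subsetIl.
have hX : X * line_stab j = X.
  apply/eqP; rewrite eqEsubset mulG_subl andbT; apply/subsetP.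
  move=> _ /mulsgP[x a /setDP[xG xA] aA ->].
  move: xA; rewrite in_setD foot_stabE => xA.
  have aB := subsetP (line_stab_sub_foot j) a aA.
  by rewrite groupMr // xA groupM // (subsetP (sAG j)).
have := sum_card_lcosetI E hX; rewrite card_line_stab.
rewrite (eq_bigr (fun=> 1%N)) => [|g /setDP[gG gB]]; last first.
  by rewrite line_stab_coset_card // -foot_stabE.
rewrite sum1_card cardsD (setIidPr _); last by rewrite foot_stabE subsetIl.
rewrite TI_cardMg ?line_stab_mul_perp_TI // card_line_stab card_perp_stab.
have -> : #|E :&: X| = (s * (s - 1))%N.
  transitivity (\sum_k #|E :&: X :&: line_stab k|)%N.
    rewrite -double_count -sum1_card; apply: eq_bigr => g.
    case/setIP=> /bigcupP[k _ gk] /setDP[_ gj]; apply/esym/eqP/cards1P.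
    exists k; apply/setP => l; rewrite in_set; apply/idP/set1P => [gl|->//].
    apply: contraNeq gj => lk; have gB := subsetP (line_stab_sub_foot k) g gk.
    by rewrite (foot_line_meet lk gl gB) foot_stabE group1.
  rewrite (bigD1 j) //= (_ : #|_| = 0%N) ?add0n.
    rewrite (eq_bigr (fun=> s.-1)).
      by rewrite sum_nat_const cardC1 card_pencil subn1.
    move=> k kj; rewrite -(card_line_stab k) (cardsD1 1 (line_stab k)) group1.
    apply: eq_card => g; rewrite in_setD1 in_setI; apply/andP/andP.
      case=> /setIP[_ /setDP[_ gX]] gk; split=> //.
      by apply: contra gX => /eqP ->; rewrite foot_stabE group1.
    case=> g1 gk; split=> //; rewrite in_setI in_setD (subsetP (sAG k)) // andbT.
    apply/andP; split; first by apply/bigcupP; exists k.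
    by rewrite foot_stabE; apply: contra g1 => gB; rewrite (foot_line_meet kj gk gB).
  apply/eqP; rewrite cards_eq0 -subset0; apply/subsetP => g.
  case/setIP => /setIP[_ /setDP[_ gX]] gj; case/negP: gX.
  by rewrite foot_stabE (subsetP (line_stab_sub_foot j)).
(* This keeps the subtraction |G| - s^2 from truncating. *)
have : (#|foot_stab j| <= #|G|)%N by rewrite subset_leq_card ?subsetIl.
rewrite -foot_stabE TI_cardMg ?line_stab_mul_perp_TI // card_line_stab card_perp_stab.
have := GQ_s_gt0; move: #|G| => c; clear; case: (s) => // n _ le.
rewrite subn1 /= => e; have : (c = n.+1 * n.+1 + n.+1 * (n.+1 * n))%N by lia.
by move=> ->; nia.
Qed.

End Elation.
End Geometry.

Theorem theorem1p1 (Pt Ln : finType) (I : Pt -> Ln -> bool) (s : nat)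
    (p : Pt) (G : {group ({perm Pt} * {perm Ln})%type}) :
  is_GQ I s s -> ~~ odd s -> is_STGQ I s p G -> is_TGQ I.
Proof.
move=> gq s_even [egq [H [sHG cH symH]]]; have [y0 py0] := GQ_noncoll gq p.
have le_s : (s <= #|perp_stab I p G|)%N.
  rewrite -cH; apply: subset_leq_card; apply/subsetP => g gH.
  by apply/perp_stabP; split; [apply: (subsetP sHG) | case: (symH g gH)].
have fam := STGQ_family gq egq py0 s_even le_s.
have cZ := card_perp_stab gq egq py0 le_s.
exists p, G; split=> //; apply: exp2_abelian.
exact: AS_config_exp2 (AS_family_config fam cZ).
Qed.
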